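(* Let $N\in\{2,3\}$, let $\alpha\in\mathbb{R}$ if $N=2$ and $\alpha<0$ if $N=3$, and let $1<p<\infty$ if $N=2$ and $1<p<2$ if $N=3$. Let $0<\omega<\omega_\alpha$ and let $\phi_\omega$ be the unique positive solution in $H^1_\alpha(\mathbb{R}^N)$ of $(\omega-\Delta_\alpha)\phi+|\phi|^{p-1}\phi=0$. Then the standing wave $e^{i\omega t}\phi_\omega(x)$ is stable in $H^1_\alpha(\mathbb{R}^N)$: for each $\varepsilon>0$ there exists $\delta>0$ such that any $H^1_\alpha$-solution $u(t)$ of $$i\partial_tu=-\Delta_\alpha u+|u|^{p-1}u,\qquad(t,x)\in\mathbb{R}\times\mathbb{R}^N,$$ with $\|u(0)-\phi_\omega\|_{H^1_\alpha}<\delta$ satisfies $$\sup_{t\in\mathbb{R}}\inf_{\theta\in\mathbb{R}}\|u(t)-e^{i\theta}\phi_\omega\|_{H^1_\alpha}<\varepsilon.$$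
   Context: All functions are complex valued and $\langle u,v\rangle=\int_{\mathbb{R}^N}u\overline{v}\,dx$. For $\lambda>0$, $G_\lambda\in L^2(\mathbb{R}^N)$ is the solution of $(\lambda-\Delta)G_\lambda=\delta_0$ in $\mathcal{D}'$. Set $\beta(\lambda)=\frac{1}{2\pi}\bigl(\gamma+\log\frac{\sqrt\lambda}{2}\bigr)$ if $N=2$ ($\gamma$ the Euler–Mascheroni constant) and $\beta(\lambda)=\frac{\sqrt\lambda}{4\pi}$ if $N=3$. $-\Delta_\alpha$ is the self-adjoint Laplacian with point interaction at the origin: its domain consists of $u=f+cG_\lambda$ with $f\in H^2(\mathbb{R}^N)$, $c\in\mathbb{C}$, $(\alpha+\beta(\lambda))c=f(0)$, and $(\lambda-\Delta_\alpha)u=(\lambda-\Delta)f$. Its unique negative eigenvalue is $e_\alpha=-4e^{-4\pi\alpha-2\gamma}$ if $N=2$ and $e_\alpha=-(4\pi\alpha)^2$ if $N=3$; $\omega_\alpha:=|e_\alpha|$. The form domain is $H^1_\alpha(\mathbb{R}^N)=\{f+cG_\lambda: f\in H^1(\mathbb{R}^N),\,c\in\mathbb{C}\}$, with form determined by $\langle-\Delta_\alpha u,u\rangle=\|\nabla f\|_{L^2}^2+\lambda\|f\|_{L^2}^2+(\alpha+\beta(\lambda))|c|^2-\lambda\|u\|_{L^2}^2$ for $u=f+cG_\lambda$ (independent of $\lambda>0$), and norm $\|u\|_{H^1_\alpha}=\sqrt{\langle-\Delta_\alpha u,u\rangle+(1+\omega_\alpha)\|u\|_{L^2}^2}$. $H^{-1}_\alpha(\mathbb{R}^N)$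 is its dual. A solution of the stationary equation is $\phi\in H^1_\alpha(\mathbb{R}^N)$ with $\langle-\Delta_\alpha\phi,w\rangle+\omega\langle\phi,w\rangle+\int|\phi|^{p-1}\phi\overline w\,dx=0$ for all $w\in H^1_\alpha(\mathbb{R}^N)$; it is known (another theorem of the paper) that for $0<\omega<\omega_\alpha$ the set of nontrivial solutions is $\{e^{i\theta}\phi_\omega:\theta\in\mathbb{R}\}$ with $\phi_\omega$ positive, radial and decreasing. An $H^1_\alpha$-solution is the maximal solution $u\in C((-T_{\min},T_{\max}),H^1_\alpha(\mathbb{R}^N))\cap C^1((-T_{\min},T_{\max}),H^{-1}_\alpha(\mathbb{R}^N))$ of the evolution equation with initial datum $u(0)\in H^1_\alpha(\mathbb{R}^N)$. It is a known background result that this exists and is unique for every $u(0)\in H^1_\alpha(\mathbb{R}^N)$, that it is global, and that it conserves the mass $\|u(t)\|_{L^2}$ and the energy $E(u)=\frac12\langle-\Delta_\alpha u,u\rangle+\frac1{p+1}\|u\|_{L^{p+1}}^{p+1}$. *)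

(* Defs.v *)
From HB Require Import structures.
From mathcomp Require Import all_boot all_order all_algebra.
From mathcomp Require Import complex.
From mathcomp Require Import all_classical all_reals all_analysis.

Set Implicit Arguments.
Unset Strict Implicit.
Unset Printing Implicit Defensive.

Import Order.TTheory GRing.Theory Num.Theory.
Import numFieldNormedType.Exports.

Local Open Scope classical_set_scope.
Local Open Scope ring_scope.
Local Open Scope complex_scope.

(* Points of R^N as a measurable space are N-tuples: tuples carry the product
    sigma-algebra, row vectors carry the normed-space structure used for
    derivatives; [row_of] identifies the two. *)

Notation Rspace R n := (n.-tuple (measurableTypeR R)).

Section space.
Variable R : realType.

Local Notation space n := (Rspace R n).

Definition row_of n (x : space n) : 'rV[R]_n := \row_i tnth x i.

Definition cons_space n (z : measurableTypeR R * space n) : space n.+1 :=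
  [tuple of z.1 :: z.2].

Lemma measurable_cons_space n : measurable_fun setT (@cons_space n).
Proof. exact: (measurable_cons measurable_fst measurable_snd). Qed.

Definition uncons_space n (t : space n.+1) : measurableTypeR R * space n :=
  (tnth t ord0, [tuple of behead t]).

Lemma measurable_uncons_space n : measurable_fun setT (@uncons_space n).
Proof.
apply/measurable_fun_pairP; split.
- exact: measurable_tnth.
- exact: measurable_behead.
Qed.

Lemma cons_spaceK n : cancel (@cons_space n) (@uncons_space n).
Proof.
by case=> a t; rewrite /uncons_space /=; congr (_, _); exact: val_inj.
Qed.

Section lebesgue_cons.
Variables (n : nat) (m : {sigma_finite_measure set (space n) -> \bar R}).

Definition lebesgue_cons : set (space n.+1) -> \bar R :=
  pushforward ((@lebesgue_measure R) \x m)%E (@cons_space n).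

Let lebesgue_cons0 : lebesgue_cons set0 = 0%E.
Proof. by rewrite /lebesgue_cons /pushforward preimage_set0 measure0. Qed.

Let lebesgue_cons_ge0 A : (0 <= lebesgue_cons A)%E.
Proof. by rewrite /lebesgue_cons /pushforward measure_ge0. Qed.

Let lebesgue_cons_sigma_additive : semi_sigma_additive lebesgue_cons.
Proof.
move=> F mF tF mUF; rewrite /lebesgue_cons /pushforward preimage_bigcup.
have mcons := @measurable_cons_space n.
apply: measure_semi_sigma_additive.
- by move=> k; rewrite -[X in measurable X]setTI; exact: mcons.
- apply/trivIsetP => /= i j _ _ ij; rewrite -preimage_setI.
  by move/trivIsetP : tF => /(_ _ _ _ _ ij) ->//; rewrite preimage_set0.
- by rewrite -preimage_bigcup -[X in measurable X]setTI; exact: mcons.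
Qed.

HB.instance Definition _ := isMeasure.Build _ _ _ lebesgue_cons
  lebesgue_cons0 lebesgue_cons_ge0 lebesgue_cons_sigma_additive.

Let lebesgue_cons_sigma_finite : sigma_finite setT lebesgue_cons.
Proof.
have /sigma_finiteP[F [TF ndF Foo]] := sigma_finiteT (@lebesgue_measure R).
have /sigma_finiteP[G [TG ndG Goo]] := sigma_finiteT m.
have muncons : measurable_fun setT (@uncons_space n) :=
  @measurable_uncons_space n.
exists (fun k => @uncons_space n @^-1` (F k `*` G k)).
  rewrite -preimage_bigcup (_ : \bigcup_i (F i `*` G i) = setT).
    by rewrite preimage_setT.
  rewrite -setXTT TF TG predeqE => -[x y]; split.
    by move=> [k _ []/= ? ?]; split; exists k.
  move=> [/= [k _ Fkx] [l _ Gly]]; exists (maxn k l) => //; split.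
  - by move: x Fkx; exact/subsetPset/ndF/leq_maxl.
  - by move: y Gly; exact/subsetPset/ndG/leq_maxr.
move=> k; have [mF F_lty] := Foo k; have [mG G_lty] := Goo k.
have mFG : measurable (F k `*` G k) by exact: measurableX.
split; first by rewrite -[X in measurable X]setTI; exact: muncons.
rewrite /lebesgue_cons /pushforward -comp_preimage.
rewrite (_ : _ \o _ = id); last by apply/funext => z; exact: cons_spaceK.
rewrite preimage_id product_measure1E//.
by rewrite lte_mul_pinfty// ge0_fin_numE.
Qed.

HB.instance Definition _ := Measure_isSigmaFinite.Build _ _ _ lebesgue_cons
  lebesgue_cons_sigma_finite.

End lebesgue_cons.

Fixpoint lebesgueN (n : nat) : {sigma_finite_measure set (space n) -> \bar R} :=
  if n is k.+1 then lebesgue_cons (lebesgueN k) else dirac ([tuple] : space 0).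

End space.

Section complex_L2.
Variables (R : realType) (N : nat).

Local Notation C := (R[i]).
Local Notation cfun := (Rspace R N -> C).
Local Notation mu := (lebesgueN R N).

Definition cintegrable (f : cfun) : Prop :=
  mu.-integrable setT (fun x => (complex.Re (f x))%:E) /\
  mu.-integrable setT (fun x => (complex.Im (f x))%:E).

Definition cintegral (f : cfun) : C :=
  (\int[mu]_x complex.Re (f x)) +i* (\int[mu]_x complex.Im (f x)).

Definition cmeasurable (f : cfun) : Prop :=
  measurable_fun setT (fun x => complex.Re (f x)) /\
  measurable_fun setT (fun x => complex.Im (f x)).

Definition L2 (f : cfun) : Prop :=
  cmeasurable f /\
  mu.-integrable setT (fun x => (Normc.normc (f x) ^+ 2)%:E).

Definition inner (u v : cfun) : C := cintegral (fun x => u x * ((v x)^*)%C).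

Definition L2norm (u : cfun) : R :=
  Num.sqrt (\int[mu]_x (Normc.normc (u x) ^+ 2)).

Definition ae_eq_cfun (u v : cfun) : Prop := {ae mu, forall x, u x = v x}.

Definition csub (u v : cfun) : cfun := fun x => u x - v x.

End complex_L2.

Section weak_derivatives.
Variables (R : realType) (N : nat).

Local Notation C := (R[i]).
Local Notation cfun := (Rspace R N -> C).

(* [partials [:: j1; ...; jk] h] is the iterated partial derivative
   d_{j1} ... d_{jk} h. *)
Definition partials (s : seq 'I_N) (h : 'rV[R]_N -> R) : 'rV[R]_N -> R :=
  foldr (fun j k => 'D_(delta_mx 0 j) k) h s.

(* Real-valued elements of C_c^infty(R^N); complex-valued test functions are
   complex combinations of these, so they define the same weak identities. *)
Definition test_function (h : 'rV[R]_N -> R) : Prop :=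
  (forall s, continuous (partials s h)) /\
  (forall s j x, derivable (partials s h) x (delta_mx 0 j)) /\
  (exists r : R, forall x, r < `|x| -> h x = 0).

Definition laplacian (h : 'rV[R]_N -> R) : 'rV[R]_N -> R :=
  fun x => \sum_(j < N) partials [:: j; j] h x.

Definition weak_gradient (f : cfun) (g : 'I_N -> cfun) : Prop :=
  (forall j, L2 (g j)) /\
  (forall h, test_function h -> forall j,
     cintegral (fun x => f x * (partials [:: j] h (row_of x))%:C) =
     - cintegral (fun x => g j x * (h (row_of x))%:C)).

Definition H1 (f : cfun) : Prop := L2 f /\ exists g, weak_gradient f g.

(* G in L^2 with (lam - Delta) G = delta_0 in D'. *)
Definition Green (lam : R) (G : cfun) : Prop :=
  L2 G /\
  (forall h, test_function h ->
     cintegral (fun x =>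
       G x * (lam * h (row_of x) - laplacian h (row_of x))%:C) = (h 0)%:C).

End weak_derivatives.

Section constants.
Variable R : realType.

Definition euler_gamma : R :=
  limn (fun n => \sum_(1 <= k < n.+1) k%:R^-1 - ln n%:R).

(* Only N = 2 and N = 3 are meaningful; the "else" branches are N = 3. *)
Definition beta_coef (N : nat) (lam : R) : R :=
  if N == 2%N then (2 * pi)^-1 * (euler_gamma + ln (Num.sqrt lam / 2))
  else Num.sqrt lam / (4 * pi).

Definition e_alpha (N : nat) (alpha : R) : R :=
  if N == 2%N then - (4 * expR (- (4 * pi * alpha) - 2 * euler_gamma))
  else - (4 * pi * alpha) ^+ 2.

Definition omega_alpha (N : nat) (alpha : R) : R := `|e_alpha N alpha|.

End constants.

Section point_interaction.
Variables (R : realType) (N : nat) (alpha : R).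

Local Notation C := (R[i]).
Local Notation cfun := (Rspace R N -> C).
Local Notation mu := (lebesgueN R N).

Variable G : R -> cfun.

(* The condition is the same for every lam > 0, as G lam - G lam' is in H^1. *)
Definition H1a (u : cfun) : Prop :=
  forall lam, 0 < lam ->
  exists f c, H1 f /\ u = (fun x => f x + c * G lam x).

(* A u w stands for <-Delta_alpha u, w>: the sesquilinear form on H^1_alpha
   (linear in u, conjugate-linear in w) determined, through polarization, by
   the given quadratic form, which is the same for all lam > 0. *)
Definition form_alpha (A : cfun -> cfun -> C) : Prop :=
  (forall a u v w, H1a u -> H1a v -> H1a w ->
     A (fun x => a * u x + v x) w = a * A u w + A v w) /\
  (forall a u v w, H1a u -> H1a v -> H1a w ->
     A w (fun x => a * u x + v x) = (a^*)%C * A w u + A w v) /\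
  (forall lam f g c, 0 < lam -> H1 f -> weak_gradient f g ->
     let u := fun x => f x + c * G lam x in
     A u u = (\sum_(j < N) L2norm (g j) ^+ 2 + lam * L2norm f ^+ 2
              + (alpha + beta_coef N lam) * Normc.normc c ^+ 2
              - lam * L2norm u ^+ 2)%:C).

Variable A : cfun -> cfun -> C.

Definition H1a_norm (u : cfun) : R :=
  Num.sqrt (complex.Re (A u u) + (1 + omega_alpha N alpha) * L2norm u ^+ 2).

(* H^{-1}_alpha: bounded conjugate-linear functionals on H^1_alpha. A function
   v acts as [inner v]. The values outside H^1_alpha are irrelevant. *)
Definition dual_norm (l : cfun -> C) : \bar R :=
  ereal_sup [set (Normc.normc (l w))%:E | w in
               [set w | H1a w /\ H1a_norm w <= 1]].

Definition Hm1a (l : cfun -> C) : Prop :=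
  (forall a u v, H1a u -> H1a v ->
     l (fun x => a * u x + v x) = (a^*)%C * l u + l v) /\
  (dual_norm l < +oo)%E.

Variable p : R.

Definition power_nonlinearity (u : cfun) : cfun :=
  fun x => (Normc.normc (u x) `^ (p - 1))%:C * u x.

Definition stationary_solution (omega : R) (phi : cfun) : Prop :=
  H1a phi /\
  (forall w, H1a w ->
     cintegrable (fun x => power_nonlinearity phi x * ((w x)^*)%C) /\
     A phi w + omega%:C * inner phi w + inner (power_nonlinearity phi) w = 0).

Definition in_interval (Tmin Tmax : \bar R) (t : R) : Prop :=
  (- Tmin < t%:E)%E /\ (t%:E < Tmax)%E.

(* u is in C(I, H^1_alpha) and C^1(I, H^{-1}_alpha), where I = (-Tmin, Tmax),
   its time derivative in H^{-1}_alpha is du, and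
   i du = -Delta_alpha u + |u|^(p-1) u holds in H^{-1}_alpha on I. *)
Definition evolution_solution (Tmin Tmax : \bar R) (u : R -> cfun) : Prop :=
  (0 < Tmin)%E /\ (0 < Tmax)%E /\
  (forall t, in_interval Tmin Tmax t -> H1a (u t)) /\
  (forall t, in_interval Tmin Tmax t ->
     H1a_norm (csub (u s) (u t)) @[s --> t] --> 0) /\
  exists du : R -> (cfun -> C),
    (forall t, in_interval Tmin Tmax t -> Hm1a (du t)) /\
    (forall t, in_interval Tmin Tmax t ->
       dual_norm (fun w => (h^-1)%:C * (inner (u (t + h)) w - inner (u t) w)
                           - du t w) @[h --> 0^'] --> 0%E) /\
    (forall t, in_interval Tmin Tmax t ->
       dual_norm (fun w => du s w - du t w) @[s --> t] --> 0%E) /\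
    (forall t, in_interval Tmin Tmax t -> forall w, H1a w ->
       cintegrable (fun x => power_nonlinearity (u t) x * ((w x)^*)%C) /\
       'i%C * du t w = A (u t) w + inner (power_nonlinearity (u t)) w).

(* The maximal solutions, i.e. the H^1_alpha-solutions; u is a total function
   of t, only its values on (-Tmin, Tmax) matter. *)
Definition H1a_solution (Tmin Tmax : \bar R) (u : R -> cfun) : Prop :=
  evolution_solution Tmin Tmax u /\
  (forall Smin Smax v, evolution_solution Smin Smax v ->
     (Tmin <= Smin)%E -> (Tmax <= Smax)%E ->
     (forall t, in_interval Tmin Tmax t -> ae_eq_cfun (v t) (u t)) ->
     Smin = Tmin /\ Smax = Tmax).

Definition energy (u : cfun) : R :=
  2^-1 * complex.Re (A u u)
  + (p + 1)^-1 * \int[mu]_x (Normc.normc (u x) `^ (p + 1)).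

(* The background theorem on the Cauchy problem: existence and uniqueness of
   the maximal solution, globality, conservation of mass and energy. *)
Definition global_wellposedness : Prop :=
  forall u0, H1a u0 ->
    (exists Tmin Tmax u,
       H1a_solution Tmin Tmax u /\ ae_eq_cfun (u 0) u0) /\
    (forall Tmin Tmax u Smin Smax v,
       H1a_solution Tmin Tmax u -> ae_eq_cfun (u 0) u0 ->
       H1a_solution Smin Smax v -> ae_eq_cfun (v 0) u0 ->
       Tmin = Smin /\ Tmax = Smax /\
       (forall t, in_interval Tmin Tmax t -> ae_eq_cfun (u t) (v t))) /\
    (forall Tmin Tmax u,
       H1a_solution Tmin Tmax u -> ae_eq_cfun (u 0) u0 ->
       Tmin = +oo%E /\ Tmax = +oo%E /\
       (forall t, L2norm (u t) = L2norm (u 0) /\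
                  energy (u t) = energy (u 0))).

End point_interaction.

Definition cexpi (R : realType) (theta : R) : R[i] := cos theta +i* sin theta.

(* Main.v *)
Require Import Defs.
From HB Require Import structures.
From mathcomp Require Import all_boot all_order all_algebra.
From mathcomp Require Import complex ring lra.
From mathcomp Require Import all_classical all_reals all_analysis.
From mathcomp Require Import measurable_realfun.

Set Implicit Arguments.
Unset Strict Implicit.
Unset Printing Implicit Defensive.

Import Order.TTheory GRing.Theory Num.Theory.
Import numFieldNormedType.Exports.

Local Open Scope classical_set_scope.
Local Open Scope ring_scope.
Local Open Scope complex_scope.

(** At lam = omega_alpha the coefficient alpha + beta(lam) vanishes, so for
    u = f + c G_lam the form is |grad f|^2 + lam |f|^2 - lam |u|^2, which is
    nonnegative when u is orthogonal to G_lam.  The form B of the operator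
    omega - Delta_alpha + |phi|^(p-1) is thus at least omega on a hyperplane;
    since it annihilates phi, it is at least omega on the orthogonal complement
    of phi.  By convexity of t -> t^((p+1)/2), the action
    S = E + (omega / 2) |.|^2 satisfies S(u) - S(phi) >= B(v, v) / 2, where v is
    the component of u orthogonal to phi.  Conservation of S then keeps v small,
    and conservation of mass keeps the modulus of the component of u along phi
    close to 1; no compactness of minimizing sequences is needed.

    Continuity of S at phi rests on well-posedness, which forces u in L^(p+1)
    for every u in H^1_alpha: a finite, convex, lower semicontinuous functional
    on the complete space H^1 is locally bounded by a Baire category argument,
    and H^1_alpha is spanned by H^1 and at most one more function. *)

(** Two bounds on S of different order meet. At time 0 only an upper bound S(u(0)) - S(phi) <= K d
    is wanted, d being the initial distance; a chord gives it, since a convex functional bounded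
    near [phi] grows at most linearly along a segment from [phi]. At time t the lower bound is
    quadratic in v. The squared distance to the orbit is therefore O(d), and delta can be taken of
    order eps^2. The sign of the nonlinearity is decisive for the lower bound: the potential energy
    is convex in |u|^2, so its tangent at |phi|^2 lies below it, and the weight |phi|^(p-1) can only
    raise the form B. Time enters through conservation alone, so the core estimate compares two
    functions of equal mass and energy. The phase theta is the argument of the coefficient of u
    along [phi], chosen separately at each time; no continuity of theta in t is involved. *)

Section real_integrals.
Context d (T : measurableType d) (R : realType).
Variable mu : {measure set T -> \bar R}.
Implicit Types f g : T -> R.

Definition rintegrable (f : T -> R) : Prop :=
  mu.-integrable setT (fun x => (f x)%:E).

Lemma rintegrable_measurable f : rintegrable f -> measurable_fun setT f.
Proof. by move=> /measurable_int /measurable_EFinP. Qed.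

Lemma rintegrable_le f g : measurable_fun setT f -> rintegrable g ->
  (forall x, `|f x| <= g x) -> rintegrable f.
Proof.
move=> mf ig fg; apply: le_integrable ig => //; first exact/measurable_EFinP.
by move=> x _ /=; rewrite lee_fin (le_trans (fg x))// ler_norm.
Qed.

Lemma rintegrableD f g : rintegrable f -> rintegrable g ->
  rintegrable (fun x => f x + g x).
Proof. by move=> i1 i2; exact: (integrableD _ i1 i2). Qed.

Lemma rintegrableZ a f : rintegrable f -> rintegrable (fun x => a * f x).
Proof. by move=> i1; exact: (integrableZl _ a i1). Qed.

Lemma rintegrableN f : rintegrable f -> rintegrable (fun x => - f x).
Proof.
move=> i1; have := rintegrableZ (-1) i1.
by rewrite /rintegrable; under eq_fun do rewrite mulN1r.
Qed.

Lemma rintegrableB f g : rintegrable f -> rintegrable g ->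
  rintegrable (fun x => f x - g x).
Proof. by move=> i1 i2; apply: rintegrableD => //; exact: rintegrableN. Qed.

Lemma rintegral_D f g : rintegrable f -> rintegrable g ->
  \int[mu]_x (f x + g x) = \int[mu]_x f x + \int[mu]_x g x.
Proof. by move=> i1 i2; exact: RintegralD. Qed.

Lemma rintegral_B f g : rintegrable f -> rintegrable g ->
  \int[mu]_x (f x - g x) = \int[mu]_x f x - \int[mu]_x g x.
Proof. by move=> i1 i2; exact: RintegralB. Qed.

Lemma rintegral_Z a f : rintegrable f ->
  \int[mu]_x (a * f x) = a * \int[mu]_x f x.
Proof. by move=> i1; exact: RintegralZl. Qed.

Lemma rintegral_le f g : rintegrable f -> rintegrable g ->
  (forall x, f x <= g x) -> \int[mu]_x f x <= \int[mu]_x g x.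
Proof. by move=> i1 i2 fg; apply: le_Rintegral. Qed.

Lemma rintegral_ge0 f : (forall x, 0 <= f x) -> 0 <= \int[mu]_x f x.
Proof. by move=> f0; exact: Rintegral_ge0. Qed.

Lemma rintegral_EFin f : rintegrable f ->
  (\int[mu]_x (f x)%:E = (\int[mu]_x f x)%:E)%E.
Proof. by move=> i1; rewrite /Rintegral fineK//; exact: integrable_fin_num. Qed.

Lemma rintegral_eq0 f : rintegrable f -> (forall x, 0 <= f x) ->
  \int[mu]_x f x = 0 -> {ae mu, forall x, f x = 0}.
Proof.
move=> i1 f0 If; have mf := rintegrable_measurable i1.
have := ae_eq_integral_abs mu measurableT
   (f := fun x => (f x)%:E) (proj2 (measurable_EFinP setT f) mf).
have -> : (\int[mu]_x `|(f x)%:E| = 0)%E.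
  under eq_integral do rewrite gee0_abs ?lee_fin ?f0//.
  by rewrite rintegral_EFin// If.
by move=> [/(_ erefl) + _]; apply: filterS => x /(_ I) [].
Qed.

Lemma rintegral_ae f g : {ae mu, forall x, f x = g x} ->
  measurable_fun setT f -> measurable_fun setT g ->
  \int[mu]_x f x = \int[mu]_x g x.
Proof.
move=> fg mf mg; rewrite /Rintegral; congr fine.
apply: ae_eq_integral => //; [exact/measurable_EFinP|exact/measurable_EFinP|].
by apply: filterS fg => x -> _.
Qed.

Lemma rintegrable_ae f g : {ae mu, forall x, f x = g x} ->
  measurable_fun setT g -> rintegrable f -> rintegrable g.
Proof.
move=> fg mg /integrableP[mf fi]; apply/integrableP; split.
  exact/measurable_EFinP.
rewrite -(@ae_eq_integral _ _ _ mu setT (fun x => `|(g x)%:E|)%E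
  (fun x => `|(f x)%:E|)%E)//.
- exact: measurableT_comp.
- by apply: measurableT_comp => //; exact/measurable_EFinP.
- by apply: filterS fg => x /= -> _.
Qed.

End real_integrals.

(** * Convexity and Young inequalities for real powers *)

Section power_inequalities.
Variable R : realType.
Implicit Types q s b : R.

(** Young's inequality for s and b^(q-1), with the conjugate exponents q and q/(q-1), multiplied by
    q, already is the tangent inequality; no derivative is taken. *)
Lemma powR_tangent q s b : 1 < q -> 0 <= s -> 0 <= b ->
  b `^ q + q * b `^ (q - 1) * (s - b) <= s `^ q.
Proof.
move=> q1 s0 b0; have q0 : 0 < q by lra.
have q10 : 0 < q - 1 by lra.
have := @conjugate_powR R s (b `^ (q - 1)) q (q / (q - 1)) s0 (powR_ge0 _ _)
  q0 (divr_gt0 q0 q10).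
have -> : q^-1 + (q / (q - 1))^-1 = 1 by field; rewrite !gt_eqF.
move=> /(_ erefl); rewrite -powRrM.
have -> : (q - 1) * (q / (q - 1)) = q by field; rewrite gt_eqF.
have -> : b `^ q / (q / (q - 1)) = b `^ q * (q - 1) / q.
  by field; rewrite !gt_eqF.
rewrite -mulrDl ler_pdivlMr// => h.
have -> : b `^ q + q * b `^ (q - 1) * (s - b) =
   s * b `^ (q - 1) * q + b `^ q - q * (b `^ (q - 1) * b) by ring.
have -> : b `^ (q - 1) * b = b `^ q.
  have [->|bn0] := eqVneq b 0; first by rewrite mulr0 powR0// gt_eqF.
  rewrite -[X in _ * X]powRr1// -powRD; last by rewrite bn0 implybT.
  by rewrite subrK.
lra.
Qed.

Lemma powR_half q s : 0 <= s -> (s ^+ 2) `^ (q / 2) = s `^ q.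
Proof.
by move=> s0; rewrite -powR_mulrn// -powRrM [_ * _]mulrC divfK.
Qed.

(** Convexity in the squared variable: with q = p + 1 the slope is (p + 1)/2 times b^(p-1), which is
    how a quadratic form with weight |phi|^(p-1) appears in [action_gap]. *)
Lemma powR_tangent_sq q s b : 2 < q -> 0 <= s -> 0 <= b ->
  b `^ q + q / 2 * b `^ (q - 2) * (s ^+ 2 - b ^+ 2) <= s `^ q.
Proof.
move=> q2 s0 b0.
have := @powR_tangent (q / 2) (s ^+ 2) (b ^+ 2) ltac:(lra) (sqr_ge0 _) (sqr_ge0 _).
rewrite !powR_half//.
have -> : q / 2 - 1 = (q - 2) / 2 by field.
by rewrite powR_half.
Qed.

Lemma powR_le2 q s t : 0 <= q -> 0 <= s -> 0 <= t ->
  (s + t) `^ q <= 2 `^ q * (s `^ q + t `^ q).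
Proof.
move=> q0 s0 t0; wlog st : s t s0 t0 / s <= t.
  by move=> h; case: (leP s t) => [|/ltW] st; [|rewrite addrC [X in _ * X]addrC];
    apply: h.
apply: (@le_trans _ _ ((2 * t) `^ q)).
  by rewrite ge0_ler_powR// ?nnegrE; lra.
rewrite powRM//; first by apply: ler_wpM2l; rewrite ?powR_ge0// lerDr powR_ge0.
Qed.

(** The larger of s and b carries all q powers. This makes weighted products integrable. *)
Lemma powR_young q s b : 2 < q -> 0 <= s -> 0 <= b ->
  b `^ (q - 2) * s ^+ 2 <= s `^ q + b `^ q.
Proof.
move=> q2 s0 b0; case: (leP s b) => sb.
  apply: (@le_trans _ _ (b `^ (q - 2) * b ^+ 2)).
    by rewrite ler_wpM2l ?powR_ge0// lerXn2r ?nnegrE.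
  have [->|bn0] := eqVneq b 0; first by rewrite expr0n mulr0 addr_ge0 ?powR_ge0.
  rewrite -powR_mulrn// -powRD; last by rewrite bn0 implybT.
  by rewrite subrK lerDr powR_ge0.
apply: (@le_trans _ _ (s `^ (q - 2) * s ^+ 2)).
  by rewrite ler_wpM2r ?sqr_ge0// ge0_ler_powR// ?nnegrE//; lra.
rewrite -powR_mulrn// -powRD; last by rewrite (gt_eqF (le_lt_trans b0 sb)) implybT.
by rewrite subrK lerDl powR_ge0.
Qed.

End power_inequalities.

(** * Real part, imaginary part and modulus of complex numbers *)

Section complex_numbers.
Variable R : rcfType.
Implicit Types z w : R[i].

Lemma ReM z w :
  complex.Re (z * w) = complex.Re z * complex.Re w - complex.Im z * complex.Im w.
Proof. by case: z => a b; case: w. Qed.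

Lemma ImM z w :
  complex.Im (z * w) = complex.Re z * complex.Im w + complex.Im z * complex.Re w.
Proof. by case: z => a b; case: w. Qed.

Lemma ReD z w : complex.Re (z + w) = complex.Re z + complex.Re w.
Proof. by case: z; case: w. Qed.

Lemma ImD z w : complex.Im (z + w) = complex.Im z + complex.Im w.
Proof. by case: z; case: w. Qed.

Lemma ReN z : complex.Re (- z) = - complex.Re z.
Proof. by case: z. Qed.

Lemma ImN z : complex.Im (- z) = - complex.Im z.
Proof. by case: z. Qed.

Lemma Re_conj z : complex.Re (z^*)%C = complex.Re z.
Proof. by case: z. Qed.

Lemma Im_conj z : complex.Im (z^*)%C = - complex.Im z.
Proof. by case: z. Qed.

Definition complexE := (ReM, ImM, ReD, ImD, ReN, ImN, Re_conj, Im_conj).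

Lemma complex_ext z w : complex.Re z = complex.Re w ->
  complex.Im z = complex.Im w -> z = w.
Proof. by case: z => a b; case: w => a' b' /= -> ->. Qed.

Lemma normc_sq z : Normc.normc z ^+ 2 = complex.Re z ^+ 2 + complex.Im z ^+ 2.
Proof. by case: z => a b /=; rewrite sqr_sqrtr ?addr_ge0 ?sqr_ge0. Qed.

Lemma normc_ge0 z : 0 <= Normc.normc z.
Proof. by case: z => a b; rewrite sqrtr_ge0. Qed.

Lemma normc_Re z : `|complex.Re z| <= Normc.normc z.
Proof. by case: z => a b /=; rewrite -sqrtr_sqr ler_wsqrtr// lerDl sqr_ge0. Qed.

Lemma normc_Im z : `|complex.Im z| <= Normc.normc z.
Proof. by case: z => a b /=; rewrite -sqrtr_sqr ler_wsqrtr// lerDr sqr_ge0. Qed.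

Lemma normc_conj z : Normc.normc (z^*)%C = Normc.normc z.
Proof. by case: z => a b /=; rewrite sqrrN. Qed.

Lemma normc_real (x : R) : Normc.normc (x%:C) = `|x|.
Proof. by rewrite /= expr0n addr0 sqrtr_sqr. Qed.

Lemma mul_conj z : z * (z^*)%C = (Normc.normc z ^+ 2)%:C.
Proof.
rewrite normc_sq; case: z => a b; apply: complex_ext => /=; ring.
Qed.

End complex_numbers.

(** * Sesquilinear forms on a domain of functions *)

Section hermitian_forms.
Variables (R : realType) (T : Type).
Local Notation C := (R[i]).
Local Notation V := (T -> C).

(** The single operation through which linearity is expressed, in the shape used by [form_alpha]; a
    multiple a u is recovered as [clin (a - 1) u u]. *)
Definition clin (a : C) (u v : V) : V := fun x => a * u x + v x.

(** Realness on the diagonal replaces Hermitian symmetry, because the point-interaction form is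
    given through its quadratic form; [form_sym] recovers the symmetry. Nothing is known of such a
    form outside its domain. *)
Record hermitian_form (D : V -> Prop) (S : V -> V -> C) : Prop := HermitianForm {
  form_dom : forall a u v, D u -> D v -> D (clin a u v);
  form_linl : forall a u v w, D u -> D v -> D w ->
    S (clin a u v) w = a * S u w + S v w;
  form_linr : forall a u v w, D u -> D v -> D w ->
    S w (clin a u v) = (a^*)%C * S w u + S w v;
  form_real : forall u, D u -> complex.Im (S u u) = 0 }.

Variables (D : V -> Prop) (S : V -> V -> C).
Hypothesis hS : hermitian_form D S.

(** Polarization: the diagonal value at a u + v is real for a = 1, which settles the imaginary
    parts, and for a = i, which settles the real parts. *)
Lemma form_sym u v : D u -> D v -> S v u = (S u v)^*%C.
Proof.
move=> Du Dv.
have key a : complex.Im (a * S u v + (a^*)%C * S v u) = 0.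
  have Dw := form_dom hS a Du Dv.
  have := form_real hS Dw; rewrite (form_linl hS)// !(form_linr hS)//.
  have := form_real hS Du; have := form_real hS Dv; rewrite !complexE.
  by move=> -> ->; lra.
have := key 1; have := key 'i%C; rewrite !complexE /= => h1 h2.
by apply: complex_ext; rewrite !complexE; lra.
Qed.

Lemma form_expand a u v : D u -> D v ->
  complex.Re (S (clin a u v) (clin a u v)) =
  Normc.normc a ^+ 2 * complex.Re (S u u) + 2 * complex.Re (a * S u v)
  + complex.Re (S v v).
Proof.
move=> Du Dv; have Dw := form_dom hS a Du Dv.
rewrite (form_linl hS)// !(form_linr hS)// (form_sym Du Dv) normc_sq !complexE.
by rewrite (form_real hS Du); ring.
Qed.

Lemma form_expand_real t u v : D u -> D v ->
  complex.Re (S (clin t%:C u v) (clin t%:C u v)) =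
  t ^+ 2 * complex.Re (S u u) + 2 * t * complex.Re (S u v) + complex.Re (S v v).
Proof.
by move=> Du Dv; rewrite form_expand// normc_real real_normK ?num_real// ReM /=; ring.
Qed.

Lemma form_expand1 u v : D u -> D v ->
  complex.Re (S (clin 1 u v) (clin 1 u v)) =
  complex.Re (S u u) + 2 * complex.Re (S u v) + complex.Re (S v v).
Proof. by move=> Du Dv; rewrite (form_expand_real 1)//; ring. Qed.

Hypothesis S_ge0 : forall u, D u -> 0 <= complex.Re (S u u).

Lemma form_cauchy_schwarz u v : D u -> D v ->
  Normc.normc (S u v) ^+ 2 <= complex.Re (S u u) * complex.Re (S v v).
Proof.
move=> Du Dv; set s := S u v; set n := Normc.normc s ^+ 2.
(* The multiplier -t conj(s) turns the cross term into the real number -t |s|^2. *)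
have key t : 0 <= t ^+ 2 * n * complex.Re (S u u) - 2 * t * n + complex.Re (S v v).
  have := S_ge0 (form_dom hS ((- t)%:C * (s^*)%C) Du Dv).
  rewrite form_expand// Normc.normcM normc_real normc_conj exprMn.
  have -> : (- t)%:C * (s^*)%C * S u v = (- t * n)%:C.
    by rewrite -mulrA [X in _ * X]mulrC mul_conj -rmorphM.
  rewrite real_normK ?num_real// sqrrN -/n /=; lra.
have := S_ge0 Du; rewrite le_eqVlt => /predU1P[U0|U0].
  rewrite -U0 mul0r leNgt; apply/negP => n0.
  (* If S(u, u) = 0 the polynomial is affine in t; at this t it equals -1. *)
  have := key ((complex.Re (S v v) + 1) / (2 * n)); rewrite -U0.
  set t := _ / _; have -> : t ^+ 2 * n * 0 - 2 * t * n = - (complex.Re (S v v) + 1).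
    by rewrite /t; field; rewrite gt_eqF.
  lra.
have := key (complex.Re (S u u))^-1.
set U := complex.Re (S u u) in U0 *.
have -> : U^-1 ^+ 2 * n * U - 2 * U^-1 * n + complex.Re (S v v) =
  (U * complex.Re (S v v) - n) / U by field; rewrite gt_eqF.
by rewrite pmulr_lge0 ?invr_gt0// subr_ge0.
Qed.

(** Nonnegativity at t u + v and at -t u + v, divided by t, bounds the real part from both sides. *)
Lemma form_young t u v : 0 < t -> D u -> D v ->
  2 * `|complex.Re (S u v)| <= t * complex.Re (S u u) + complex.Re (S v v) / t.
Proof.
move=> t0 Du Dv.
have key s : s ^+ 2 = t ^+ 2 ->
  - (2 * s * complex.Re (S u v)) <= t * (t * complex.Re (S u u) + complex.Re (S v v) / t).
  move=> st; have := S_ge0 (form_dom hS s%:C Du Dv).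
  rewrite form_expand_real// st mulrDr [X in _ -> _ <= _ + X]mulrC divfK ?gt_eqF//; lra.
rewrite -(ler_pM2l t0); have := key t erefl; have := key (- t) (sqrrN _).
by case: ler0P; lra.
Qed.

Lemma form_parallelogram u v : D u -> D v ->
  complex.Re (S (clin 1 u v) (clin 1 u v)) <=
  2 * complex.Re (S u u) + 2 * complex.Re (S v v).
Proof.
move=> Du Dv; rewrite form_expand1//; have := form_young (@ltr01 _) Du Dv.
have := ler_norm (complex.Re (S u v)); lra.
Qed.

End hermitian_forms.

(** * The L^2 inner product as a Hermitian form *)

Section complex_integrals.
Variables (R : realType) (N : nat).
Local Notation C := (R[i]).
Local Notation cfun := (Rspace R N -> C).
Local Notation mu := (lebesgueN R N).
Implicit Types f g u v : cfun.

Lemma cmeasurable_clin a f g :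
  cmeasurable f -> cmeasurable g -> cmeasurable (clin a f g).
Proof.
move=> [f1 f2] [g1 g2]; split; rewrite /clin; under eq_fun do rewrite !complexE.
  by apply: measurable_funD => //; apply: measurable_funB; apply: measurable_funM.
by apply: measurable_funD => //; apply: measurable_funD; apply: measurable_funM.
Qed.

Lemma cmeasurable_mul f g :
  cmeasurable f -> cmeasurable g -> cmeasurable (fun x => f x * g x).
Proof.
move=> [f1 f2] [g1 g2]; split; under eq_fun do rewrite !complexE.
  by apply: measurable_funB; apply: measurable_funM.
by apply: measurable_funD; apply: measurable_funM.
Qed.

Lemma cmeasurable_conj f : cmeasurable f -> cmeasurable (fun x => ((f x)^*)%C).
Proof.
move=> [f1 f2]; split; first by under eq_fun do rewrite Re_conj.
by under eq_fun do rewrite Im_conj; exact: measurable_funN.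
Qed.

Lemma cmeasurable_real (h : Rspace R N -> R) :
  measurable_fun setT h -> cmeasurable (fun x => (h x)%:C).
Proof. by move=> mh; split => //=; exact: measurable_cst. Qed.

Lemma measurable_normc f : cmeasurable f ->
  measurable_fun setT (fun x => Normc.normc (f x)).
Proof.
move=> [f1 f2].
have -> : (fun x => Normc.normc (f x)) =
  fun x => (complex.Re (f x) ^+ 2 + complex.Im (f x) ^+ 2) `^ (2^-1).
  by apply/funext => x; rewrite powR12_sqrt ?addr_ge0 ?sqr_ge0//; case: (f x).
apply: (@measurableT_comp _ _ _ _ _ _ (fun y : R => y `^ 2^-1)).
  exact: measurable_powR.
by apply: measurable_funD; exact: measurable_funX.
Qed.

Lemma cintegrable_le f (g : Rspace R N -> R) : cmeasurable f ->
  rintegrable mu g -> (forall x, Normc.normc (f x) <= g x) -> cintegrable f.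
Proof.
move=> [f1 f2] ig fg; split; apply: (rintegrable_le _ ig) => // x.
  exact: le_trans (normc_Re _) (fg x).
exact: le_trans (normc_Im _) (fg x).
Qed.

Lemma cintegral_clin a f g : cintegrable f -> cintegrable g ->
  cintegral (clin a f g) = a * cintegral f + cintegral g.
Proof.
move=> [f1 f2] [g1 g2]; have Z := @rintegrableZ _ _ _ mu.
apply: complex_ext; rewrite /cintegral !complexE /= /clin.
  under eq_Rintegral do rewrite !complexE.
  rewrite rintegral_D//; last by apply: rintegrableB; apply: Z.
  by rewrite rintegral_B ?rintegral_Z//; apply: Z.
under eq_Rintegral do rewrite !complexE.
rewrite rintegral_D//; last by apply: rintegrableD; apply: Z.
by rewrite rintegral_D ?rintegral_Z//; apply: Z.
Qed.

Lemma rintegrable_normc2 f : L2 f -> rintegrable mu (fun x => Normc.normc (f x) ^+ 2).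
Proof. by case. Qed.

Lemma L2norm_sq f : L2norm f ^+ 2 = \int[mu]_x (Normc.normc (f x) ^+ 2).
Proof. by rewrite sqr_sqrtr// rintegral_ge0// => x; rewrite sqr_ge0. Qed.

Lemma L2_clin a f g : L2 f -> L2 g -> L2 (clin a f g).
Proof.
move=> [mf f2] [mg g2]; have mm := cmeasurable_clin a mf mg; split => //.
apply: (@rintegrable_le _ _ _ mu _ (fun x =>
  2 * Normc.normc a ^+ 2 * Normc.normc (f x) ^+ 2 + 2 * Normc.normc (g x) ^+ 2)).
- exact: measurable_funX (measurable_normc mm).
- by apply: rintegrableD; apply: rintegrableZ.
- move=> x; rewrite ger0_norm ?sqr_ge0// /clin.
  have := le_normcD (a * f x) (g x); rewrite Normc.normcM.
  set s := Normc.normc (_ + _); set t := Normc.normc a * _.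
  rewrite -mulrA -exprMn -/t => st.
  have s0 : 0 <= s by exact: normc_ge0.
  have : s ^+ 2 <= (t + Normc.normc (g x)) ^+ 2.
    by rewrite lerXn2r// nnegrE (le_trans s0 st).
  have := sqr_ge0 (t - Normc.normc (g x)); rewrite !sqrrD sqrrN; lra.
Qed.

Lemma cintegrable_inner f g : L2 f -> L2 g ->
  cintegrable (fun x => f x * ((g x)^*)%C).
Proof.
move=> [mf f2] [mg g2].
apply: (@cintegrable_le _ (fun x => Normc.normc (f x) ^+ 2 + Normc.normc (g x) ^+ 2)).
- exact: cmeasurable_mul mf (cmeasurable_conj mg).
- exact: rintegrableD.
- move=> x; rewrite Normc.normcM normc_conj.
  set s := Normc.normc (f x); set t := Normc.normc (g x).
  have := sqr_ge0 (s - t); have : 0 <= s by exact: normc_ge0.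
  have : 0 <= t by exact: normc_ge0.
  rewrite sqrrD sqrrN; nra.
Qed.

Lemma inner_self f : inner f f = (L2norm f ^+ 2)%:C.
Proof.
rewrite L2norm_sq /inner /cintegral; apply: complex_ext => /=.
  by apply: eq_Rintegral => x _; rewrite mul_conj.
by under eq_Rintegral do rewrite mul_conj /=; rewrite Rintegral_cst// mul0r.
Qed.

Lemma hermitian_inner : hermitian_form (@L2 R N) (@inner R N).
Proof.
split.
- exact: L2_clin.
- move=> a u v w Du Dv Dw; rewrite /inner.
  rewrite -cintegral_clin; [|exact: cintegrable_inner..].
  by congr cintegral; apply/funext => x; rewrite /clin mulrDl mulrA.
- move=> a u v w Du Dv Dw; rewrite /inner.
  rewrite -cintegral_clin; [|exact: cintegrable_inner..].
  congr cintegral; apply/funext => x; rewrite /clin rmorphD rmorphM mulrDr.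
  by rewrite mulrCA.
- by move=> u Du; rewrite inner_self.
Qed.

Lemma inner_ge0 u : 0 <= complex.Re (inner u u).
Proof. by rewrite inner_self sqr_ge0. Qed.

Lemma inner_cauchy_schwarz u v : L2 u -> L2 v ->
  Normc.normc (inner u v) <= L2norm u * L2norm v.
Proof.
move=> Du Dv.
have := form_cauchy_schwarz hermitian_inner (fun w _ => inner_ge0 w) Du Dv.
rewrite !inner_self /= -exprMn ler_pXn2r// nnegrE ?normc_ge0//.
by rewrite mulr_ge0// sqrtr_ge0.
Qed.

End complex_integrals.

(** * Measure of boxes, and measurability of continuous functions *)

Section lebesgue_tuples.
Variable R : realType.

Definition box n (r : R) : set (Rspace R n) :=
  [set x | forall i, `|tnth x i| <= r].

Lemma measurable_box n r : measurable (@box n r).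
Proof.
have -> : @box n r = \bigcap_(i in [set: 'I_n]) [set x | `|tnth x i| <= r].
  by apply/seteqP; split => x /= h i //; [move=> _; exact: h | exact: h].
apply: fin_bigcap_measurable => // i _.
have mi : measurable_fun setT (fun x : Rspace R n => `|tnth x i|).
  by apply: measurableT_comp => //; exact: measurable_tnth.
have -> : [set x : Rspace R n | `|tnth x i| <= r] =
  setT `&` (fun x : Rspace R n => `|tnth x i|) @^-1` `]-oo, r].
  by rewrite setTI; apply/seteqP; split => x /=; rewrite in_itv.
exact: mi.
Qed.

Lemma lebesgueN_box n r : (lebesgueN R n (box r) < +oo)%E.
Proof.
elim: n => [|n IH].
  rewrite (_ : box r = setT) ?diracT ?ltry//.
  by apply/seteqP; split => // x _ [].
have -> : lebesgueN R n.+1 (box r) =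
    ((@lebesgue_measure R) \x (lebesgueN R n))%E (`[- r, r] `*` box r).
  rewrite /= /lebesgue_cons /pushforward; congr (_ _).
  apply/seteqP; split => -[a x] /=.
    move=> h; split => [|i]; first by have := h ord0; rewrite in_itv /= -ler_norml.
    by have := h (lift ord0 i); rewrite !(tnth_nth 0).
  move=> [ha hx] i; case: (unliftP ord0 i) => [j ->|->].
    by have := hx j; rewrite !(tnth_nth 0).
  by move: ha; rewrite in_itv /= -ler_norml.
rewrite product_measure1E//; last exact: measurable_box.
rewrite lte_mul_pinfty// ge0_fin_numE//.
have := @lebesgue_measure_itv R `[- r, r] => /= ->.
by case: ifP => // _; rewrite ltry.
Qed.

(** Serves to contradict [phi] = 0 almost everywhere. *)
Lemma lebesgueN_setT_gt0 n : (0 < lebesgueN R n setT)%E.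
Proof.
elim: n => [|n IH]; first by rewrite /= diracT lte01.
have -> : lebesgueN R n.+1 setT =
    ((@lebesgue_measure R) \x (lebesgueN R n))%E (setT `*` setT).
  by rewrite /= /lebesgue_cons /pushforward preimage_setT setXTT.
rewrite product_measure1E// mule_gt0//.
have := @lebesgue_measure_itv R `]-oo, +oo[; rewrite set_itvNyy => E.
by rewrite [ltRHS]E /= adde_gt0// ltry.
Qed.

(* [h] is the pointwise limit of its values at the roundings of [x] to the
   grids [(Z / k.+1)^n]; these take countably many values. *)
Lemma measurable_continuous_row n (h : 'rV[R]_n -> R) : continuous h ->
  measurable_fun setT (fun x : Rspace R n => h (row_of x)).
Proof.
move=> ch.
pose z k (x : Rspace R n) : {ffun 'I_n -> int} :=
  [ffun i => Num.floor (k.+1%:R * tnth x i)].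
pose y k (c : {ffun 'I_n -> int}) : 'rV[R]_n := \row_i ((c i)%:~R / k.+1%:R).
apply: (@measurable_fun_cvg _ _ _ _ (fun k x => h (y k (z k x)))).
  move=> k _ B mB; rewrite setTI.
  have -> : (fun x => h (y k (z k x))) @^-1` B =
    \bigcup_c (if `[< B (h (y k c)) >] then [set x | z k x = c] else set0).
    apply/seteqP; split => x /=.
      by move=> Bx; exists (z k x) => //; case: asboolP.
    by move=> [c _]; case: asboolP => //= Bc ->.
  apply: countable_bigcupT_measurable => [|c]; first exact: countableP.
  case: ifP => // _.
  have -> : [set x | z k x = c] = \bigcap_(i in [set: 'I_n])
     [set x : Rspace R n | (c i)%:~R <= k.+1%:R * tnth x i < (c i + 1)%:~R].
    apply/seteqP; split => x /=.
      by move=> <- i _ /=; rewrite ffunE floor_itv.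
    by move=> h1; apply/ffunP => i; rewrite ffunE; apply: floor_def; exact: h1.
  apply: fin_bigcap_measurable => // i _.
  have mi : measurable_fun setT (fun x : Rspace R n => k.+1%:R * tnth x i).
    by apply: measurable_funM => //; exact: measurable_tnth.
  have := mi measurableT `[(c i)%:~R, (c i + 1)%:~R[%classic (measurable_itv _).
  by rewrite setTI; congr measurable; apply/seteqP; split => x /=; rewrite in_itv.
move=> x _; apply: (cvg_comp _ _ _ (ch (row_of x))) => A [P nP sP].
have H i : \forall k \near \oo, P ord0 i (y k (z k x) ord0 i).
  have := nP ord0 i => /nbhs_ballP[e /= e0 eP].
  near=> k; apply: eP; rewrite /ball /= !mxE ffunE.
  have k0 : 0 < k.+1%:R :> R by rewrite ltr0n.
  have /andP[f1 f2] := floor_itv (k.+1%:R * tnth x i).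
  rewrite intrD in f2.
  have -> : tnth x i - (Num.floor (k.+1%:R * tnth x i))%:~R / k.+1%:R =
    (k.+1%:R * tnth x i - (Num.floor (k.+1%:R * tnth x i))%:~R) / k.+1%:R.
    by field; rewrite gt_eqF.
  rewrite ger0_norm ?divr_ge0 ?subr_ge0// ?ltW//.
  apply: (@le_lt_trans _ _ k.+1%:R^-1).
    by rewrite ler_pdivrMr// mulVf ?gt_eqF//; lra.
  by near: k; exact: near_infty_natSinv_lt (PosNum e0).
have : \forall k \near \oo, forall i, P ord0 i (y k (z k x) ord0 i).
  exact: filter_forall.
by apply: filterS => k hk; apply: sP => i j; rewrite ord1.
Unshelve. all: by end_near. Qed.

End lebesgue_tuples.

(** * Square integrability of test functions and their derivatives *)

Section test_functions.
Variables (R : realType) (N : nat).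
Local Notation mu := (lebesgueN R N).
Implicit Types h : 'rV[R]_N -> R.

Definition compactly_supported h := exists r : R, forall x, r < `|x| -> h x = 0.

Lemma compactly_supported_bounded h : continuous h -> compactly_supported h ->
  exists2 M, 0 <= M & forall x, `|h x| <= M.
Proof.
move=> ch [r hr].
(* [r] may be negative; the maximum with 0 keeps the ball nonempty for the extreme value theorem. *)
pose B : set 'rV[R]_N := [set x | `|x| <= Num.max r 0].
have cB : compact B.
  apply: bounded_closed_compact.
    exists (Num.max r 0); split; first exact: num_real.
    by move=> t rt x /= /le_trans; apply; exact: ltW.
  apply: (@closed_comp _ _ (fun y : 'rV[R]_N => `|y|) [set z | z <= Num.max r 0]).
    by move=> *; exact: norm_continuous.
  exact: closed_le.
have B0 : B !=set0 by exists 0; rewrite /B /= normr0 le_max lexx orbT.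
have [|c _ hc] := @EVT_max_rV R N (fun x => `|h x|) B B0 cB.
  apply: continuous_subspaceT => x.
  by apply: continuous_comp; [exact: ch|exact: norm_continuous].
exists `|h c| => // x; case: (leP `|x| (Num.max r 0)) => xr.
  by apply: hc; rewrite inE.
by rewrite hr ?normr0// (le_lt_trans _ xr)// le_max lexx.
Qed.

Lemma compactly_supported_L2 h : continuous h -> compactly_supported h ->
  L2 (fun x : Rspace R N => (h (row_of x))%:C).
Proof.
move=> ch sh; have [M M0 hM] := compactly_supported_bounded ch sh.
have [r hr] := sh.
have mh := measurable_continuous_row ch; split; first exact: cmeasurable_real.
have ind : rintegrable mu (\1_(box r)).
  have mb : measurable (@box R N r) by exact: measurable_box.
  apply/integrableP; split; first exact/measurable_EFinP.
  under eq_integral do rewrite gee0_abs ?lee_fin//.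
  by rewrite integral_indic// setIT lebesgueN_box.
apply: (rintegrable_le (g := fun x => M ^+ 2 * \1_(box r) x)).
- by apply: measurable_funX; apply: measurable_normc; exact: cmeasurable_real.
- exact: rintegrableZ.
move=> x; rewrite normc_real real_normK ?num_real// ger0_norm ?sqr_ge0//.
rewrite indicE; case: (boolP (x \in box r)) => xr.
  by rewrite mulr1 -(real_normK (num_real (h _))) lerXn2r ?nnegrE.
rewrite hr ?expr0n ?mulr0// ltNge; apply: contra xr => xr; rewrite inE => i.
apply: le_trans xr; rewrite [leRHS]/Num.norm /= mx_normrE.
by apply/bigmax_geP; right => /=; exists (ord0, i) => //=; rewrite mxE.
Qed.

Lemma test_function_L2 h : test_function h ->
  L2 (fun x : Rspace R N => (h (row_of x))%:C).
Proof. by move=> [ch [_ sh]]; apply: compactly_supported_L2 => //; exact: (ch [::]). Qed.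

(** Beyond the support radius [h] vanishes on an open set, so its partials vanish there too and the
    same radius works. *)
Lemma test_function_partial_L2 h j : test_function h ->
  L2 (fun x : Rspace R N => (partials [:: j] h (row_of x))%:C).
Proof.
move=> [ch [_ [r sh]]]; apply: compactly_supported_L2; first exact: (ch [:: j]).
exists r => x rx /=; rewrite (@near_eq_derive _ _ _ h (cst 0)) ?derive_cst//.
have oB : open [set y : 'rV[R]_N | r < `|y|].
  apply: (@open_comp _ _ (fun y : 'rV[R]_N => `|y|) [set z | r < z]).
    by move=> *; exact: norm_continuous.
  exact: open_gt.
apply: (@filterS _ _ _ [set y : 'rV[R]_N | r < `|y|]); first by move=> y /sh.
exact: open_nbhs_nbhs.
Qed.

End test_functions.

(** * Completeness of L^2 *)

Section square_integrable_limits.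
Variables (R : realType) (N : nat).
Local Notation C := (R[i]).
Local Notation cfun := (Rspace R N -> C).
Local Notation mu := (lebesgueN R N).
Implicit Types f g u v : cfun.

Lemma L2_csub u v : L2 u -> L2 v -> L2 (csub u v).
Proof.
move=> Lu Lv; have := L2_clin (-1) Lv Lu.
by congr L2; apply/funext => x; rewrite /clin /csub mulN1r addrC.
Qed.

Lemma csub_clin u v : csub u v = clin (-1) v u.
Proof. by apply/funext => x; rewrite /clin /csub mulN1r addrC. Qed.

Lemma L2norm_clin_le u v : L2 u -> L2 v ->
  L2norm (clin 1 u v) ^+ 2 <= 2 * L2norm u ^+ 2 + 2 * L2norm v ^+ 2.
Proof.
move=> Lu Lv.
have := form_parallelogram (@hermitian_inner R N) (fun w _ => inner_ge0 w) Lu Lv.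
by rewrite !inner_self.
Qed.

(** Since 2|t| <= 2^-k + 2^k t^2, a bound on weighted squares makes the telescoping series
    absolutely convergent. Squared increments are what the L^2 norm controls. *)
Lemma sq_series_cvg (u : R^nat) (K : R) :
  (forall n, \sum_(0 <= k < n) 2 ^+ k * (u k.+1 - u k) ^+ 2 <= K) -> cvgn u.
Proof.
move=> hK.
suff : cvgn (series (telescope u)).
  move=> c; have -> : u = (fun n => u 0%N + series (telescope u) n).
    by apply/funext => n; exact: eq_sum_telescope.
  by apply: is_cvgD => //; exact: is_cvg_cst.
have v0 k : 0 <= (1 / 2) ^+ k + 2 ^+ k * (u k.+1 - u k) ^+ 2.
  apply: addr_ge0; first by apply: exprn_ge0; lra.
  by apply: mulr_ge0; [exact: exprn_ge0|exact: sqr_ge0].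
apply: normed_cvg.
apply: (@series_le_cvg _ _ (fun k => (1 / 2) ^+ k + 2 ^+ k * (u k.+1 - u k) ^+ 2)) => //.
- by move=> k; rewrite /= normr_ge0.
- move=> k; rewrite /= /telescope; set t := u k.+1 - u k.
  have a0 : 0 < (2 : R) ^+ k by rewrite exprn_gt0.
  have -> : (1 / 2 : R) ^+ k = (2 ^+ k)^-1 by rewrite div1r exprVn.
  have h : 0 <= (1 - 2 ^+ k * `|t|) ^+ 2 / 2 ^+ k by rewrite divr_ge0 ?sqr_ge0 ?ltW.
  have e : (1 - 2 ^+ k * `|t|) ^+ 2 / 2 ^+ k =
     (2 ^+ k)^-1 - 2 * `|t| + 2 ^+ k * `|t| ^+ 2 by field; rewrite gt_eqF.
  rewrite e real_normK ?num_real// in h.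
  have := normr_ge0 t; lra.
apply: nondecreasing_is_cvgn.
  apply/nondecreasing_seqP => n; rewrite !seriesEnat/= big_nat_recr//= lerDl /=.
  exact: v0.
exists (2 + K) => _ [n _ <-]; rewrite seriesEnat /= big_split /= lerD//.
suff -> : \sum_(0 <= k < n) (1 / 2 : R) ^+ k = 2 - 2 * (1 / 2) ^+ n.
  by rewrite lerBlDr lerDl mulr_ge0// exprn_ge0//; lra.
elim: n => [|n IH]; first by rewrite big_nil expr0; lra.
by rewrite big_nat_recr//= IH exprS; lra.
Qed.

Section cauchy.
Variables (x : nat -> cfun) (r : nat -> R).
Hypothesis Lx : forall n, L2 (x n).
Hypothesis hx : forall n, L2norm (csub (x n.+1) (x n)) ^+ 2 <= r n.
Hypothesis hr : forall n, 8 * r n.+1 <= r n.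

Let r0 n : 0 <= r n.
Proof. by apply: le_trans (hx n); exact: sqr_ge0. Qed.

(** The decay factor 8 closes the induction on [j]: splitting off the first increment gives 2 (4
    r_{n+1}) + 2 r_n <= 3 r_n. *)
Lemma L2_cauchy_dist n j : L2norm (csub (x (n + j)) (x n)) ^+ 2 <= 4 * r n.
Proof.
elim: j n => [|j IH] n.
  rewrite addn0 L2norm_sq (_ : (fun _ => _) = cst 0).
    by rewrite Rintegral_cst// mul0r mulr_ge0.
  by apply/funext => y; rewrite /csub subrr Normc.normc0 expr0n.
have -> : csub (x (n + j.+1)) (x n) =
   clin 1 (csub (x (n.+1 + j)) (x n.+1)) (csub (x n.+1) (x n)).
  apply/funext => y; rewrite /csub /clin addSnnS; ring.
apply: le_trans (L2norm_clin_le (L2_csub (Lx _) (Lx _)) (L2_csub (Lx _) (Lx _))) _.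
have := IH n.+1; have := hx n; have := hr n; have := r0 n; lra.
Qed.

Let r_geom n : r n <= r 0%N / 8 ^+ n.
Proof.
elim: n => [|n IH]; first by rewrite expr0 divr1.
have -> : r 0%N / 8 ^+ n.+1 = (r 0%N / 8 ^+ n) / 8.
  by rewrite exprS; field; rewrite expf_neq0.
have := hr n; lra.
Qed.

Let w k (y : Rspace R N) : R := 2 ^+ k * Normc.normc (csub (x k.+1) (x k) y) ^+ 2.

Let w0 k y : 0 <= w k y.
Proof. by rewrite mulr_ge0// ?sqr_ge0 ?exprn_ge0. Qed.

Let iw k : rintegrable mu (w k).
Proof. by apply: rintegrableZ; apply: rintegrable_normc2; exact: L2_csub. Qed.

Let W y : \bar R := (\sum_(k <oo) (w k y)%:E)%E.

Let mW : measurable_fun setT W.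
Proof.
apply: ge0_emeasurable_sum => [k y _ _|k _]; first by rewrite lee_fin.
by apply/measurable_EFinP; exact: rintegrable_measurable (iw k).
Qed.

Let W0 y : (0 <= W y)%E.
Proof. by apply: nneseries_ge0 => k _ _; rewrite lee_fin. Qed.

(** The integral of [w k] is at most 2^k r_0 / 8^k = r_0 / 4^k, so [W] has a finite integral. *)
Let W_ae : {ae mu, forall y, (W y < +oo)%E}.
Proof.
have : mu.-integrable setT W.
  apply/integrableP; split => //.
  under eq_integral do rewrite gee0_abs//.
  have -> : (\int[mu]_y W y = \sum_(k <oo) \int[mu]_y (w k y)%:E)%E.
    apply: integral_nneseries => // [k|k y _]; last by rewrite lee_fin.
    by apply/measurable_EFinP; exact: rintegrable_measurable (iw k).
  apply: (@le_lt_trans _ _ (2 * r 0%N)%:E); last exact: ltry.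
  apply: lime_le.
    apply: is_cvg_nneseries => k _ _.
    by apply: integral_ge0 => y _; rewrite lee_fin.
  apply: nearW => n; rewrite big_mkord.
  under eq_bigr do rewrite (rintegral_EFin (iw _)).
  rewrite sumEFin lee_fin.
  apply: (@le_trans _ _ (\sum_(i < n) r 0%N * (1 / 4) ^+ i)).
    apply: ler_sum => i _; rewrite rintegral_Z; last first.
      by apply: rintegrable_normc2; exact: L2_csub.
    rewrite -L2norm_sq; have h1 := le_trans (hx i) (r_geom i).
    apply: (@le_trans _ _ (2 ^+ i * (r 0%N / 8 ^+ i))).
      by rewrite ler_wpM2l ?exprn_ge0.
    have -> : (8 : R) ^+ i = 2 ^+ i * 4 ^+ i by rewrite -exprMn; congr (_ ^+ _); ring.
    rewrite div1r exprVn le_eqVlt; apply/orP; left; apply/eqP.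
    by field; rewrite !expf_neq0.
  rewrite -mulr_sumr mulrC ler_wpM2r//.
  have -> : \sum_(i < n) (1 / 4 : R) ^+ i = 4 / 3 - 4 / 3 * (1 / 4) ^+ n.
    elim: n => [|n IH]; first by rewrite big_ord0 expr0; lra.
    by rewrite big_ord_recr/= IH exprS; lra.
  have : 0 <= (1 / 4 : R) ^+ n by rewrite exprn_ge0//; lra.
  lra.
move/integrable_ae => /(_ measurableT); apply: filterS => y /(_ I).
by rewrite ge0_fin_numE.
Qed.

Let Dset := [set y | (W y < +oo)%E].

Let mD : measurable Dset.
Proof.
by rewrite -[Dset]setTI; exact: emeasurable_fun_infty_o.
Qed.

Let x_cvg y : Dset y -> cvgn (fun n => complex.Re (x n y)) /\
  cvgn (fun n => complex.Im (x n y)).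
Proof.
move=> Dy.
have hK n : \sum_(0 <= k < n) w k y <= fine (W y).
  rewrite -lee_fin fineK ?ge0_fin_numE//.
  rewrite -sumEFin; apply: nneseries_lim_ge => k _ _; rewrite lee_fin//.
split; apply: (@sq_series_cvg _ (fine (W y))) => n; apply: le_trans (hK n);
  apply: ler_sum => k _; rewrite ler_wpM2l ?exprn_ge0// /csub normc_sq !complexE.
  by rewrite lerDl sqr_ge0.
by rewrite lerDr sqr_ge0.
Qed.

(** The limit is taken pointwise where [W] is finite and set to 0 elsewhere, which makes it
    measurable; Fatou's lemma carries the Cauchy bound over to it. *)
Lemma L2_complete : exists2 y, L2 y & forall n, L2norm (csub y (x n)) ^+ 2 <= 4 * r n.
Proof.
pose ylim (F : C -> R) t := if t \in Dset then limn (fun n => F (x n t)) else 0.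
have ycvg (F : C -> R) t : (Dset t -> cvgn (fun n => F (x n t))) ->
    (fun n => \1_Dset t * F (x n t)) @ \oo --> ylim F t.
  move=> h; rewrite /ylim indicE; case: ifPn => [|_].
    by rewrite inE => /h ch; under eq_fun do rewrite mul1r.
  by under eq_fun do rewrite mul0r; exact: cvg_cst.
have yRe t := ycvg (@complex.Re R) t (fun Dt => (x_cvg Dt).1).
have yIm t := ycvg (@complex.Im R) t (fun Dt => (x_cvg Dt).2).
pose y : cfun := fun t => ylim (@complex.Re R) t +i* ylim (@complex.Im R) t.
have my : cmeasurable y.
  split.
    apply: (@measurable_fun_cvg _ _ _ _ (fun n t => \1_Dset t * complex.Re (x n t))) => //.
    by move=> n; apply: measurable_funM => //; exact: (Lx n).1.1.
  apply: (@measurable_fun_cvg _ _ _ _ (fun n t => \1_Dset t * complex.Im (x n t))) => //.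
  by move=> n; apply: measurable_funM => //; exact: (Lx n).1.2.
pose e n t := Normc.normc (csub y (x n) t) ^+ 2.
have me n : measurable_fun setT (e n).
  apply: measurable_funX; apply: measurable_normc; rewrite csub_clin.
  by apply: cmeasurable_clin => //; exact: (Lx n).1.
pose f n m t := \1_Dset t * Normc.normc (csub (x (n + m)%N) (x n) t) ^+ 2.
have fe n m t : f n m t =
   (\1_Dset t * complex.Re (x (n + m)%N t) - \1_Dset t * complex.Re (x n t)) ^+ 2 +
   (\1_Dset t * complex.Im (x (n + m)%N t) - \1_Dset t * complex.Im (x n t)) ^+ 2.
  rewrite /f /csub normc_sq !complexE indicE; case: (t \in Dset) => /=; ring.
have mf n m : measurable_fun setT (f n m).
  apply: measurable_funM => //; apply: measurable_funX; apply: measurable_normc.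
  exact: (L2_csub (Lx _) (Lx _)).1.
have f_cvg n t : (fun m => f n m t) @ \oo --> \1_Dset t * e n t.
  have -> : \1_Dset t * e n t =
     (ylim (@complex.Re R) t - \1_Dset t * complex.Re (x n t)) ^+ 2 +
     (ylim (@complex.Im R) t - \1_Dset t * complex.Im (x n t)) ^+ 2.
    rewrite /e /csub normc_sq !complexE /= /ylim indicE.
    by case: (t \in Dset) => /=; rewrite ?mul1r ?mul0r ?subrr ?expr0n ?addr0.
  under eq_fun do rewrite fe.
  have shift (u : R^nat) (l : R) : u @ \oo --> l -> (fun m => u (n + m)%N) @ \oo --> l.
    move=> ul; have -> : (fun m => u (n + m)%N) = [sequence u (m + n)%N]_m.
      by apply/funext => m; rewrite addnC.
    by rewrite cvg_shiftn.
  have cRe := shift (fun m => \1_Dset t * complex.Re (x m t)) _ (yRe t).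
  have cIm := shift (fun m => \1_Dset t * complex.Im (x m t)) _ (yIm t).
  have sq (u : R^nat) (l c : R) : u @ \oo --> l ->
      (fun m => (u m - c) ^+ 2) @ \oo --> (l - c) ^+ 2.
    move=> ul; rewrite expr2; under eq_fun do rewrite expr2.
    by apply: cvgM; (apply: cvgB; [exact: ul|exact: cvg_cst]).
  exact: cvgD (sq _ _ _ cRe) (sq _ _ _ cIm).
have De n : (\int[mu]_t (\1_Dset t * e n t)%:E <= (4 * r n)%:E)%E.
  have := @fatou _ _ _ mu setT measurableT (fun m t => (f n m t)%:E).
  move=> /(_ (fun m => proj2 (measurable_EFinP _ _) (mf n m))).
  have f0 m t : 0 <= f n m t by rewrite mulr_ge0// sqr_ge0.
  move=> /(_ (fun m t _ => f0 m t)).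
  rewrite (_ : (fun t => limn_einf _) = fun t => (\1_Dset t * e n t)%:E); last first.
    apply/funext => t; have ft : (fun m => (f n m t)%:E) @ \oo --> (\1_Dset t * e n t)%:E.
      by apply: cvg_EFin; [exact: nearW|exact: f_cvg].
    by rewrite is_cvg_limn_einfE; [exact/cvg_lim|apply/cvg_ex; eexists; exact: ft].
  move=> /le_trans; apply; rewrite limn_einf_lim; apply: lime_le.
    exact: is_cvg_einfs.
  apply: nearW => m; apply: (@le_trans _ _ (\int[mu]_t (f n m t)%:E)%E).
    by apply: ereal_inf_lbound; exists m => //=.
  have L := L2_csub (Lx (n + m)%N) (Lx n).
  apply: (@le_trans _ _ (\int[mu]_t (Normc.normc (csub (x (n + m)%N) (x n) t) ^+ 2)%:E)%E).
    apply: ge0_le_integral => //; try by move=> t _; rewrite lee_fin ?f0 ?sqr_ge0.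
    - exact/measurable_EFinP.
    - by apply/measurable_EFinP; exact: rintegrable_measurable L.2.
    - move=> t _; rewrite lee_fin /f indicE; case: (t \in Dset) => /=.
        by rewrite mul1r.
      by rewrite mul0r sqr_ge0.
  by rewrite (rintegral_EFin L.2) -L2norm_sq lee_fin L2_cauchy_dist.
have De_ae n : {ae mu, forall t, \1_Dset t * e n t = e n t}.
  by apply: filterS W_ae => t Wt; rewrite indicE mem_set// mul1r.
have iDe n : rintegrable mu (fun t => \1_Dset t * e n t).
  apply/integrableP; split; first by apply/measurable_EFinP; exact: measurable_funM.
  have De0 t : 0 <= \1_Dset t * e n t by rewrite mulr_ge0// sqr_ge0.
  under eq_integral do rewrite gee0_abs ?lee_fin//.
  exact: le_lt_trans (De n) (ltry _).
have ie n : rintegrable mu (e n) by exact: rintegrable_ae (De_ae n) (me n) (iDe n).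
have Ly : L2 y.
  have -> : y = clin 1 (csub y (x 0%N)) (x 0%N).
    by apply/funext => t; rewrite /clin /csub mul1r subrK.
  apply: L2_clin => //; split; last exact: ie.
  by rewrite csub_clin; apply: cmeasurable_clin => //; exact: (Lx 0%N).1.
exists y => // n; rewrite L2norm_sq -(rintegral_ae (De_ae n)) ?me//.
  by rewrite -lee_fin -rintegral_EFin//; exact: De.
exact: rintegrable_measurable (iDe n).
Qed.

End cauchy.

End square_integrable_limits.

Lemma geometric_decay_lt (R : realType) (r : nat -> R) e :
  (forall n, 8 * r n.+1 <= r n) -> 0 < e -> exists n, 4 * r n < e.
Proof.
move=> hr e0.
have rg n : r n * 8 ^+ n <= r 0%N.
  elim: n => [|n IH]; first by rewrite mulr1.
  rewrite exprS mulrA; apply: le_trans IH; rewrite ler_wpM2r ?exprn_ge0//.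
  by have := hr n; lra.
pose n := (Num.truncn (4 * r 0%N / e)).+1.
have hn : 4 * r 0%N / e < n%:R by exact: truncnS_gt.
have n8 : n%:R <= 8 ^+ n :> R by rewrite -natrX ler_nat ltnW// ltn_expl.
exists n; have := rg n; rewrite ltr_pdivrMr// in hn.
have e8 : 0 < (8 : R) ^+ n by rewrite exprn_gt0.
move=> h; rewrite -(ltr_pM2r e8).
apply: le_lt_trans (_ : _ <= 4 * r 0%N) _; first by lra.
by apply: lt_le_trans hn _; rewrite mulrC ler_pM2l.
Qed.

(** * The space H^1 and its completeness *)

Section sobolev.
Variables (R : realType) (N : nat).
Local Notation C := (R[i]).
Local Notation cfun := (Rspace R N -> C).
Local Notation mu := (lebesgueN R N).
Implicit Types f u v : cfun.

Definition rfun (h : 'rV[R]_N -> R) : cfun := fun x => (h (row_of x))%:C.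

(** Conjugation is invisible on real functions, so test pairings become inner products, to which
    sesquilinearity and Cauchy-Schwarz apply. *)
Lemma cintegral_rfun f h :
  cintegral (fun x => f x * (h (row_of x))%:C) = inner f (rfun h).
Proof.
rewrite /inner; congr cintegral; apply/funext => x.
by congr (_ * _); apply: complex_ext; rewrite !complexE //= oppr0.
Qed.

Lemma weak_gradientE f g : weak_gradient f g <->
  (forall j, L2 (g j)) /\
  (forall h, test_function h -> forall j,
    inner f (rfun (partials [:: j] h)) = - inner (g j) (rfun h)).
Proof.
split=> -[Lg H]; split => // h th j; have := H h th j;
  by rewrite !cintegral_rfun.
Qed.

Lemma weak_gradient_clin a f g f' g' : L2 f -> L2 f' ->
  weak_gradient f g -> weak_gradient f' g' ->
  weak_gradient (clin a f f') (fun j => clin a (g j) (g' j)).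
Proof.
move=> Lf Lf' /weak_gradientE[Lg H] /weak_gradientE[Lg' H'].
apply/weak_gradientE; split => [j|h th j]; first exact: L2_clin.
have L1 := test_function_L2 th; have L2 := test_function_partial_L2 j th.
by rewrite !(form_linl (@hermitian_inner R N))// H// H'// opprD mulrN.
Qed.

(** By Cauchy-Schwarz both sides of the weak identity are continuous in L^2, so the defect [E] of
    the limit is at most e [K] for every e > 0. *)
Lemma weak_gradient_lim f g : L2 f -> (forall j, L2 (g j)) ->
  (forall e, 0 < e -> exists f' g', [/\ L2 f', weak_gradient f' g',
     L2norm (csub f f') <= e & forall j, L2norm (csub (g j) (g' j)) <= e]) ->
  weak_gradient f g.
Proof.
move=> Lf Lg H; apply/weak_gradientE; split => // h th j.
have L1 := test_function_L2 th; have L2h := test_function_partial_L2 j th.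
apply/eqP; rewrite -subr_eq0 opprK; apply/eqP/Normc.eq0_normc.
set E := _ + _; set K := L2norm (rfun (partials [:: j] h)) + L2norm (rfun h).
have K0 : 0 <= K by rewrite addr_ge0 ?sqrtr_ge0.
have key e : 0 < e -> Normc.normc E <= e * K.
  move=> /H[f' [g' [Lf' /weak_gradientE[Lg' H'] hf hg]]].
  have -> : E = inner (csub f f') (rfun (partials [:: j] h)) +
                inner (csub (g j) (g' j)) (rfun h).
    rewrite /E !csub_clin !(form_linl (@hermitian_inner R N))//.
    by rewrite H'//; ring.
  apply: le_trans (le_normcD _ _) _; rewrite mulrDr lerD//.
    apply: le_trans (inner_cauchy_schwarz (L2_csub Lf Lf') L2h) _.
    by rewrite ler_wpM2r// sqrtr_ge0.
  apply: le_trans (inner_cauchy_schwarz (L2_csub (Lg j) (Lg' j)) L1) _.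
  by rewrite ler_wpM2r// sqrtr_ge0.
apply/eqP; rewrite eq_le normc_ge0 andbT; apply/ler_addgt0Pr => e e0.
rewrite add0r; apply: le_trans (key (e / (K + 1)) _) _.
  by rewrite divr_gt0// ltr_wpDl.
rewrite mulrAC ler_pdivrMr ?ltr_wpDl// ler_pM2l//; lra.
Qed.

Lemma H1_clin a f f' : H1 f -> H1 f' -> H1 (clin a f f').
Proof.
move=> [Lf [g Hg]] [Lf' [g' Hg']]; split; first exact: L2_clin.
by eexists; exact: weak_gradient_clin Hg Hg'.
Qed.

(** The gradient is an argument rather than chosen from [f], so that it can be carried along sums
    and limits. *)
Definition sobolev_sq f (g : 'I_N -> cfun) : R :=
  L2norm f ^+ 2 + \sum_(j < N) L2norm (g j) ^+ 2.

Lemma sobolev_sq_ge0 f g : 0 <= sobolev_sq f g.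
Proof. by rewrite addr_ge0 ?sqr_ge0// sumr_ge0// => j _; rewrite sqr_ge0. Qed.

Lemma L2norm_le_sobolev f g : L2norm f ^+ 2 <= sobolev_sq f g.
Proof. by rewrite lerDl sumr_ge0// => j _; rewrite sqr_ge0. Qed.

Lemma L2norm_grad_le_sobolev f g j : L2norm (g j) ^+ 2 <= sobolev_sq f g.
Proof.
rewrite /sobolev_sq (bigD1 j)//= addrCA lerDl addr_ge0 ?sqr_ge0// sumr_ge0//.
by move=> i _; rewrite sqr_ge0.
Qed.

Lemma sobolev_sq_clin a f g f' g' : L2 f -> L2 f' ->
  (forall j, L2 (g j)) -> (forall j, L2 (g' j)) ->
  sobolev_sq (clin a f f') (fun j => clin a (g j) (g' j)) <=
  2 * Normc.normc a ^+ 2 * sobolev_sq f g + 2 * sobolev_sq f' g'.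
Proof.
have key u v : L2 u -> L2 v -> L2norm (clin a u v) ^+ 2 <=
    2 * Normc.normc a ^+ 2 * L2norm u ^+ 2 + 2 * L2norm v ^+ 2.
  move=> Lu Lv; have L0 : L2 (clin (a - 1) u u) by exact: L2_clin.
  have eau : clin (a - 1) u u = fun x => a * u x.
    by apply/funext => x; rewrite /clin mulrBl mul1r subrK.
  have -> : clin a u v = clin 1 (clin (a - 1) u u) v.
    by apply/funext => x; rewrite eau /clin mul1r.
  apply: le_trans (L2norm_clin_le L0 Lv) _; rewrite -mulrA lerD2r ler_pM2l//.
  rewrite eau !L2norm_sq -rintegral_Z; last exact: Lu.2.
  by under eq_Rintegral do rewrite Normc.normcM exprMn.
move=> Lf Lf' Lg Lg'; rewrite /sobolev_sq !mulrDr !mulr_sumr.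
rewrite [leRHS]addrACA -big_split /= lerD ?key//.
by apply: ler_sum => j _; exact: key.
Qed.

(** Completeness of L^2 is applied to the functions and to each partial derivative; closedness of
    the weak gradient matches the limits. *)
Lemma H1_complete (x : nat -> cfun) (G : nat -> 'I_N -> cfun) (r : nat -> R) :
  (forall n, L2 (x n)) -> (forall n, weak_gradient (x n) (G n)) ->
  (forall n, 8 * r n.+1 <= r n) ->
  (forall n, sobolev_sq (csub (x n.+1) (x n))
     (fun j => csub (G n.+1 j) (G n j)) <= r n) ->
  exists2 y, H1 y & forall n, L2norm (csub y (x n)) ^+ 2 <= 4 * r n.
Proof.
move=> Lx HG hr hx; have LG n j : L2 (G n j) by exact: (HG n).1.
have [y Ly hy] := L2_complete Lx (fun n => le_trans (L2norm_le_sobolev _ _) (hx n)) hr.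
have hz j : exists z, L2 z /\ forall n, L2norm (csub z (G n j)) ^+ 2 <= 4 * r n.
  have [z Lz Hz] := L2_complete (fun n => LG n j)
    (fun n => le_trans (L2norm_grad_le_sobolev _ _ j) (hx n)) hr.
  by exists z.
have [z Hz] := choice hz.
exists y => //; split => //; exists z.
apply: weak_gradient_lim => // [j|e e0]; first exact: (Hz j).1.
have [n rn] := geometric_decay_lt hr (exprn_gt0 2 e0).
have le_e s : 0 <= s -> s ^+ 2 <= 4 * r n -> s <= e.
  by move=> s0 hs; rewrite -(@ler_pXn2r _ 2)// ?nnegrE ?ltW//; lra.
exists (x n), (G n); split => // [|j]; apply: le_e; rewrite ?sqrtr_ge0//.
exact: (Hz j).2.
Qed.

End sobolev.

(** * The functional [Phi]: convexity and lower semicontinuity *)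

Section power_functional.
Variables (R : realType) (N : nat) (q : R).
Hypothesis q2 : 2 < q.
Local Notation C := (R[i]).
Local Notation cfun := (Rspace R N -> C).
Local Notation mu := (lebesgueN R N).
Implicit Types f u v : cfun.

Let q0 : 0 <= q. Proof. by move: q2; lra. Qed.
Let q1 : 1 < q. Proof. by move: q2; lra. Qed.

Definition Lq u : Prop :=
  cmeasurable u /\ rintegrable mu (fun x => Normc.normc (u x) `^ q).

(** A nonintegrable power would receive the default value 0, so upper bounds on [Phi] are meaningful
    only together with [Lq]. *)
Definition Phi u : R := \int[mu]_x (Normc.normc (u x) `^ q).

Lemma Phi_ge0 u : 0 <= Phi u.
Proof. by apply: rintegral_ge0 => x; exact: powR_ge0. Qed.

Lemma measurable_power r u : cmeasurable u ->
  measurable_fun setT (fun x => Normc.normc (u x) `^ r).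
Proof.
move=> mu_; apply: (@measurableT_comp _ _ _ _ _ _ (fun y : R => y `^ r)).
  exact: measurable_powR.
exact: measurable_normc.
Qed.

Lemma Lq_clin a u v : Lq u -> Lq v -> Lq (clin a u v).
Proof.
move=> [mu_ iu] [mv iv]; have mm := cmeasurable_clin a mu_ mv; split => //.
apply: (rintegrable_le (measurable_power q mm)
  (rintegrableZ (2 `^ q) (rintegrableD (rintegrableZ (Normc.normc a `^ q) iu) iv))).
move=> x; rewrite ger0_norm ?powR_ge0// -powRM ?normc_ge0// -Normc.normcM.
apply: le_trans (powR_le2 q0 (normc_ge0 _) (normc_ge0 _)).
apply: ge0_ler_powR; rewrite ?nnegrE ?normc_ge0 ?addr_ge0 ?normc_ge0//.
exact: le_normcD.
Qed.

Lemma Phi_le2 u v : Lq u -> Lq v -> Phi (clin 1 u v) <= 2 `^ q * (Phi u + Phi v).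
Proof.
move=> Lu Lv; have iD := rintegrableD Lu.2 Lv.2.
rewrite /Phi -(rintegral_D Lu.2 Lv.2) -(rintegral_Z _ iD).
apply: rintegral_le; [exact: (Lq_clin 1 Lu Lv).2|exact: rintegrableZ|].
move=> x; apply: le_trans (powR_le2 q0 (normc_ge0 _) (normc_ge0 _)).
apply: ge0_ler_powR; rewrite ?nnegrE ?normc_ge0 ?addr_ge0 ?normc_ge0//.
by rewrite /clin mul1r le_normcD.
Qed.

Lemma Phi_ae u v : ae_eq_cfun u v -> cmeasurable u -> cmeasurable v ->
  Phi u = Phi v.
Proof.
move=> uv mu_ mv; apply: rintegral_ae; try exact: measurable_power.
by apply: filterS uv => x ->.
Qed.

Lemma Lq_ae u v : ae_eq_cfun u v -> cmeasurable v -> Lq u -> Lq v.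
Proof.
move=> uv mv [mu_ iu]; split => //.
apply: rintegrable_ae (measurable_power _ mv) iu.
by apply: filterS uv => x ->.
Qed.

(** The tangent inequalities at s = (1 - t) a + t b are averaged with weights 1 - t and t; the
    linear terms cancel. *)
Lemma Phi_segment t u z : 0 <= t <= 1 -> Lq u -> Lq z ->
  Phi (fun x => (1 - t)%:C * u x + t%:C * z x) <= (1 - t) * Phi u + t * Phi z.
Proof.
move=> /andP[t0 t1] Lu Lz.
pose w : cfun := fun x => (1 - t)%:C * u x + t%:C * z x.
have Lw : Lq w.
  have -> : w = clin (1 - t)%:C u (clin (t - 1)%:C z z).
    apply/funext => x; rewrite /clin /w; congr (_ + _).
    by rewrite rmorphB mulrBl mul1r subrK.
  by apply: Lq_clin => //; exact: Lq_clin.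
have iu := rintegrableZ (1 - t) Lu.2; have iz := rintegrableZ t Lz.2.
rewrite /Phi -(rintegral_Z _ Lu.2) -(rintegral_Z _ Lz.2) -(rintegral_D iu iz).
apply: rintegral_le; [exact: Lw.2|exact: rintegrableD|].
move=> x; set a := Normc.normc (u x); set b := Normc.normc (z x).
have a0 : 0 <= a by exact: normc_ge0.
have b0 : 0 <= b by exact: normc_ge0.
pose s := (1 - t) * a + t * b.
have s0 : 0 <= s by rewrite addr_ge0 ?mulr_ge0// subr_ge0.
apply: (@le_trans _ _ (s `^ q)).
  apply: ge0_ler_powR; rewrite ?nnegrE ?normc_ge0//.
  apply: le_trans (le_normcD _ _) _; rewrite !Normc.normcM !normc_real.
  by rewrite !ger0_norm// subr_ge0.
have ha := powR_tangent q1 a0 s0; have hb := powR_tangent q1 b0 s0.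
have : (1 - t) * (s `^ q + q * s `^ (q - 1) * (a - s)) +
       t * (s `^ q + q * s `^ (q - 1) * (b - s)) <= (1 - t) * a `^ q + t * b `^ q.
  by rewrite lerD// ler_wpM2l// subr_ge0.
apply: le_trans; rewrite le_eqVlt; apply/orP; left; apply/eqP.
by rewrite {4 7}/s; ring.
Qed.

(** The tangent at |u| has slope q |u|^(q-1), which need not be square integrable. Where |u| <= k it
    is at most c |u|, so the error is a product of two L^2 functions; by dominated convergence a
    large k keeps the truncated integral above [M]. *)
Lemma Phi_lsc u M : L2 u -> Lq u -> M < Phi u -> exists2 rho, 0 < rho &
  forall y, L2 y -> Lq y -> L2norm (csub y u) ^+ 2 <= rho -> M < Phi y.
Proof.
move=> Lu Lqu MPhi.
pose E (k : nat) := [set x | Normc.normc (u x) <= k%:R].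
have mE k : measurable (E k).
  rewrite -[E k]setTI; have := measurable_normc Lu.1.
  move=> /(_ measurableT `]-oo, k%:R]%classic (measurable_itv _)).
  by congr measurable; apply/seteqP; split => x /=; rewrite in_itv.
pose T k x := \1_(E k) x * Normc.normc (u x) `^ q.
have mT k : measurable_fun setT (T k).
  by apply: measurable_funM => //; exact: measurable_power Lu.1.
have T0 k x : 0 <= T k x by rewrite mulr_ge0// powR_ge0.
have Tle k x : T k x <= Normc.normc (u x) `^ q.
  by rewrite /T indicE; case: (_ \in _) => /=; rewrite ?mul1r ?mul0r ?powR_ge0.
have iT k : rintegrable mu (T k).
  by apply: rintegrable_le Lqu.2 _ => // x; rewrite ger0_norm.
have Tcvg x : (fun k => T k x) @ \oo --> Normc.normc (u x) `^ q.
  apply: cvg_near_cst; near=> k; rewrite /T indicE mem_set ?mul1r//= /E /=.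
  by near: k; exact: nbhs_infty_ger.
have [k Mk] : exists k, M < \int[mu]_x T k x.
  have cvgT : (fun k => (\int[mu]_x (T k x)%:E)%E) @ \oo -->
      (\int[mu]_x (Normc.normc (u x) `^ q)%:E)%E.
    apply: (@dominated_cvg _ _ _ mu setT _ (fun k x => (T k x)%:E) _
      (fun x => (Normc.normc (u x) `^ q)%:E)) => //.
    - by move=> k; exact/measurable_EFinP.
    - by move=> x _; apply: cvg_EFin; [exact: nearW|exact: Tcvg].
    - exact: Lqu.2.
    - by move=> k x _; rewrite /= lee_fin ger0_norm.
  rewrite (rintegral_EFin Lqu.2) in cvgT.
  have [k _ /(_ k (leqnn k)) hk] := cvgr_gt _ (fine_cvg cvgT) _ MPhi.
  by exists k; exact: hk.
have [c cE] : exists c, c = q * k%:R `^ (q - 2) + 1 by eexists.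
have c1 : 1 <= c by rewrite cE lerDr mulr_ge0 ?powR_ge0.
have c0 : 0 < c by lra.
pose D := \int[mu]_x T k x - M.
have D0 : 0 < D by rewrite subr_gt0.
pose m := L2norm u ^+ 2.
have m0 : 0 <= m by exact: sqr_ge0.
(* The margin [D] is shared out: with this [eta] and the radius chosen below, each of the two error
   terms is at most D/4. *)
pose eta := D / (2 * c * (m + 1)).
have m1 : 0 < m + 1 by lra.
have eta0 : 0 < eta by rewrite divr_gt0// ?mulr_gt0.
exists (eta * D / (2 * c)) => [|y Ly Lqy hy].
  by apply: divr_gt0; apply: mulr_gt0.
have Lyu := L2_csub Ly Lu.
have pt x : T k x - c / 2 * (eta * Normc.normc (u x) ^+ 2 +
     eta^-1 * Normc.normc (csub y u x) ^+ 2) <= Normc.normc (y x) `^ q.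
  set a := Normc.normc (u x); set b := Normc.normc (csub y u x).
  have a0 : 0 <= a by exact: normc_ge0.
  have b0 : 0 <= b by exact: normc_ge0.
  have yc : 0 <= Normc.normc (y x) by exact: normc_ge0.
  have amgm : a * b <= (eta * a ^+ 2 + eta^-1 * b ^+ 2) / 2.
    have h : 0 <= (eta * a - b) ^+ 2 / eta by rewrite divr_ge0 ?sqr_ge0 ?ltW.
    have e : (eta * a - b) ^+ 2 / eta = eta * a ^+ 2 + eta^-1 * b ^+ 2 - 2 * (a * b).
      by field; rewrite gt_eqF.
    rewrite e in h; lra.
  have cab : c * (a * b) <= c / 2 * (eta * a ^+ 2 + eta^-1 * b ^+ 2).
    by rewrite -mulrA [2^-1 * _]mulrC ler_pM2l.
  apply: (@le_trans _ _ (T k x - c * (a * b))); first by rewrite lerD2l lerN2.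
  rewrite /T indicE; case: (boolP (x \in E k)) => [|_]; last first.
    rewrite mul0r sub0r; apply: (@le_trans _ _ 0); last exact: powR_ge0.
    by rewrite oppr_le0 !mulr_ge0// ltW.
  rewrite inE /E /= -/a => ak; rewrite mul1r.
  apply: le_trans (powR_tangent q1 yc a0).
  have ayb : a - Normc.normc (y x) <= b.
    rewrite lerBlDl -[b]normcN; have := le_normcD (y x) (- csub y u x).
    by rewrite /csub opprB addrC subrK.
  rewrite lerD2l lerNl -mulrN opprB.
  have p0 : 0 <= q * a `^ (q - 1) by rewrite mulr_ge0 ?powR_ge0.
  apply: (@le_trans _ _ (q * a `^ (q - 1) * b)); first by rewrite ler_wpM2l.
  rewrite mulrA ler_wpM2r//.
  have -> : a `^ (q - 1) = a `^ (q - 2) * a.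
    have [->|an0] := eqVneq a 0; first by rewrite mulr0 powR0// subr_eq0 gt_eqF.
    rewrite -[X in _ * X]powRr1// -powRD; last by rewrite an0 implybT.
    by congr powR; ring.
  rewrite mulrA ler_wpM2r// cE (@le_trans _ _ (q * k%:R `^ (q - 2)))//.
    by rewrite ler_wpM2l// ge0_ler_powR ?nnegrE ?subr_ge0// ltW.
  by rewrite lerDl.
have i1 : rintegrable mu (fun x => eta * Normc.normc (u x) ^+ 2).
  by apply: rintegrableZ; exact: Lu.2.
have i2 : rintegrable mu (fun x => eta^-1 * Normc.normc (csub y u x) ^+ 2).
  by apply: rintegrableZ; exact: Lyu.2.
have i3 := rintegrableZ (c / 2) (rintegrableD i1 i2).
have := rintegral_le (rintegrableB (iT k) i3) Lqy.2 pt.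
rewrite (rintegral_B (iT k) i3) (rintegral_Z _ (rintegrableD i1 i2)).
rewrite (rintegral_D i1 i2) (rintegral_Z _ Lu.2) (rintegral_Z _ Lyu.2).
rewrite -!L2norm_sq -/m => hle; apply: lt_le_trans hle.
have h1 : c / 2 * (eta * m) <= D / 4.
  have -> : c / 2 * (eta * m) = D / 4 * (m / (m + 1)).
    by rewrite /eta; field; rewrite !gt_eqF.
  apply: ler_piMr; first by rewrite divr_ge0 ?ltW.
  by rewrite ler_pdivrMr//; lra.
have h2 : c / 2 * (eta^-1 * L2norm (csub y u) ^+ 2) <= D / 4.
  apply: (@le_trans _ _ (c / 2 * (eta^-1 * (eta * D / (2 * c))))).
    apply: ler_wpM2l; first by rewrite divr_ge0// ltW.
    by apply: ler_wpM2l => //; rewrite invr_ge0 ltW.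
  by rewrite le_eqVlt; apply/orP; left; apply/eqP; field; rewrite !gt_eqF.
rewrite mulrDr; have : M = \int[mu]_x T k x - D by rewrite /D; ring.
lra.
Unshelve. all: by end_near. Qed.

End power_functional.

Fact common_radius (R : realFieldType) (r s : R) : 0 < r -> 0 < s ->
  exists m, [/\ 0 < m, 4 * m <= r & 8 * m <= s].
Proof.
move=> r0 s0; exists (Num.min (r / 4) (s / 8)).
have h1 : Num.min (r / 4) (s / 8) <= r / 4 by rewrite ge_min lexx.
have h2 : Num.min (r / 4) (s / 8) <= s / 8 by rewrite ge_min lexx orbT.
by split; [rewrite lt_min !divr_gt0|lra|lra].
Qed.

(** * Local boundedness of [Phi] on H^1 *)

Section local_boundedness.
Variables (R : realType) (N : nat) (q : R).
Hypothesis q2 : 2 < q.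
Local Notation C := (R[i]).
Local Notation cfun := (Rspace R N -> C).
Local Notation Lq := (@Lq R N q).
Local Notation Phi := (@Phi R N q).
Hypothesis H1_Lq : forall f : cfun, H1 f -> Lq f.

(* [Phi] is finite and lower semicontinuous on the complete space [H1]: were it
   unbounded near [0], nested balls on which [Phi > n - 1] would meet. *)
Lemma Phi_H1_bounded : exists M r : R, 0 < r /\ forall f g,
  L2 f -> weak_gradient f g -> sobolev_sq f g <= r -> Phi f <= M.
Proof.
apply: contrapT => unbounded.
have large (M r : R) : 0 < r -> exists f g,
    [/\ L2 f, weak_gradient f g, sobolev_sq f g <= r & M < Phi f].
  move=> r0; apply: contrapT => h; apply: unbounded; exists M, r; split => //.
  move=> f g Lf Hg fr; rewrite leNgt; apply/negP => Mf.
  by apply: h; exists f, g.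
pose state := (cfun * ('I_N -> cfun) * R)%type.
(* The balls are measured in L^2 alone, where [Phi] is already lower semicontinuous; the factor 4 is
   that of [H1_complete], so the limit lies in all of them. With n - 1 the stage n = 0 follows from
   [Phi_ge0]. *)
pose good n (s : state) := [/\ L2 s.1.1, weak_gradient s.1.1 s.1.2, 0 < s.2 &
  forall y, L2 y -> Lq y -> L2norm (csub y s.1.1) ^+ 2 <= 4 * s.2 -> n%:R - 1 < Phi y].
pose next (s s' : state) := sobolev_sq (csub s'.1.1 s.1.1)
  (fun j => csub (s'.1.2 j) (s.1.2 j)) <= s.2 /\ 8 * s'.2 <= s.2.
have step n s : good n s -> exists s', good n.+1 s' /\ next s s'.
  move: s => [[x g] rho] [/= Lx Hg rho0 hrho].
  (* As d = (x + d) - x, [Phi_le2] gives Phi(d) <= 2^q (Phi(x + d) + Phi(x)); this size of Phi(d)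
     forces Phi(x + d) > n. *)
  have [d [gd [Ld Hgd dr dPhi]]] := large (2 `^ q * (n%:R + Phi x)) rho rho0.
  have H1x : H1 x by split => //; exists g.
  have H1d : H1 d by split => //; exists gd.
  pose x' := clin 1 d x.
  have H1x' : H1 x' by exact: H1_clin.
  have dE : d = clin 1 x' (clin (- 2%:R) x x).
    by apply/funext => z; rewrite /clin /x' /clin; ring.
  have Phi2x : Phi (clin (- 2%:R) x x) = Phi x.
    congr (Rintegral _ _ _); apply/funext => z; rewrite /clin.
    have -> : - 2%:R * x z + x z = - x z by ring.
    by rewrite normcN.
  have q20 : 0 < (2 : R) `^ q by exact: powR_gt0.
  have x'Phi : n%:R < Phi x'.
    have := Phi_le2 q2 (H1_Lq H1x') (Lq_clin q2 (- 2%:R) (H1_Lq H1x) (H1_Lq H1x)).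
    rewrite -dE Phi2x => h; have := lt_le_trans dPhi h.
    by rewrite (ltr_pM2l q20) ltrD2r; apply.
  clear dPhi Phi2x dE.
  have [r r0 hr] := Phi_lsc q2 H1x'.1 (H1_Lq H1x') x'Phi.
  (* [m4] keeps the new ball within the reach of semicontinuity; [m8] supplies the geometric
     decay. *)
  have [m [m0 m4 m8]] := common_radius r0 rho0.
  exists (x', (fun j => clin 1 (gd j) (g j)), m); split.
    split; [exact: H1x'.1|exact: weak_gradient_clin|exact: m0|].
    move=> y Ly Lqy hy; rewrite -natr1 addrK.
    exact: hr Ly Lqy (le_trans hy m4).
  split; last exact: m8.
  have dE : csub x' x = d by apply/funext => z; rewrite /csub /x' /clin; ring.
  have gdE : (fun j => csub (clin 1 (gd j) (g j)) (g j)) = gd.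
    by apply/funext => j; apply/funext => z; rewrite /csub /clin; ring.
  by rewrite /= dE gdE; exact: dr.
have [s0 hs0] : exists s, good 0%N s.
  have [f [g [Lf Hg _ _]]] := large 0 1 ltr01; exists (f, g, 1); split => //=.
  by move=> y _ _ _; have := Phi_ge0 q y; lra.
have total_step (ns : nat * state) : exists s',
    good ns.1 ns.2 -> good ns.1.+1 s' /\ next ns.2 s'.
  case: ns => n s; have [h|h] := pselect (good n s); last by exists s.
  by have [s' hs'] := step n s h; exists s'.
have [F hF] := choice total_step.
pose fix seqs n := if n is k.+1 then F (k, seqs k) else s0.
have gs n : good n (seqs n) by elim: n => [|n IH] //=; exact: (hF (n, seqs n) IH).1.
have ns n : next (seqs n) (seqs n.+1) by exact: (hF (n, seqs n) (gs n)).2.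
have [y Hy hy] := @H1_complete R N (fun n => (seqs n).1.1) (fun n => (seqs n).1.2)
  (fun n => (seqs n).2) (fun n => let: And4 a _ _ _ := gs n in a)
  (fun n => let: And4 _ a _ _ := gs n in a) (fun n => (ns n).2) (fun n => (ns n).1).
have big n : n%:R - 1 < Phi y.
  by have [_ _ _ h] := gs n; apply: h => //; [exact: Hy.1|exact: H1_Lq].
have := truncnS_gt (Phi y + 1); have := big (Num.truncn (Phi y + 1)).+1; lra.
Qed.

End local_boundedness.

(** * Polar form, and combinations of forms *)

Lemma cexpi_polar (R : realType) (z : R[i]) :
  exists theta, z = (Normc.normc z)%:C * cexpi theta.
Proof.
have [->|z0] := eqVneq z 0; first by exists 0; rewrite Normc.normc0 mul0r.
have n0 : 0 < Normc.normc z.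
  rewrite lt_def normc_ge0 andbT; apply: contraNneq z0 => /Normc.eq0_normc.
  by move=> ->.
pose x := complex.Re z / Normc.normc z; pose y := complex.Im z / Normc.normc z.
have xy : x ^+ 2 + y ^+ 2 = 1.
  by rewrite !expr_div_n -mulrDl -normc_sq divff// expf_neq0// gt_eqF.
have x1 : -1 <= x <= 1.
  have : x ^+ 2 <= 1 by rewrite -xy lerDl sqr_ge0.
  rewrite -ler_norml -[1 in X in _ <= X](expr1n _ 2) -real_normK ?num_real//.
  by rewrite ler_pXn2r ?nnegrE.
pose theta := if 0 <= y then acos x else - acos x.
exists theta.
have -> : cexpi theta = x +i* y.
  have sx : Num.sqrt (1 - x ^+ 2) = `|y|.
    by rewrite -xy addrAC subrr add0r sqrtr_sqr.
  rewrite /cexpi /theta; case: ifPn => [y0|]; last rewrite -ltNge => y0.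
    by rewrite acosK// sin_acos// sx ger0_norm.
  by rewrite cosN sinN acosK// sin_acos// sx ltr0_norm// opprK.
apply: complex_ext; rewrite !complexE /x /y /=; field; rewrite gt_eqF//.
Qed.

Section forms.
Variables (R : realType) (T : Type).
Local Notation V := (T -> R[i]).
Implicit Types (D : V -> Prop) (S : V -> V -> R[i]).

Lemma hermitian_formD D S1 S2 (r : R) : hermitian_form D S1 ->
  hermitian_form D S2 -> hermitian_form D (fun u w => S1 u w + r%:C * S2 u w).
Proof.
move=> h1 h2; split; first exact: form_dom h1.
- by move=> a u v w Du Dv Dw; rewrite (form_linl h1)// (form_linl h2)//; ring.
- by move=> a u v w Du Dv Dw; rewrite (form_linr h1)// (form_linr h2)//; ring.
- move=> u Du; rewrite !complexE (form_real h1)// (form_real h2)//=; ring.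
Qed.

Lemma hermitian_form_sub D D' S : hermitian_form D' S ->
  (forall a u v, D u -> D v -> D (clin a u v)) -> (forall u, D u -> D' u) ->
  hermitian_form D S.
Proof.
move=> h cD DD'; split=> //.
- by move=> a u v w /DD' ? /DD' ? /DD' ?; exact: (form_linl h).
- by move=> a u v w /DD' ? /DD' ? /DD' ?; exact: (form_linr h).
- by move=> u /DD'; exact: (form_real h).
Qed.

Lemma form_scale D S a u : hermitian_form D S -> D u ->
  D (fun x => a * u x) /\ complex.Re (S (fun x => a * u x) (fun x => a * u x)) =
    Normc.normc a ^+ 2 * complex.Re (S u u).
Proof.
move=> h Du; have -> : (fun x => a * u x) = clin (a - 1) u u.
  by apply/funext => x; rewrite /clin mulrBl mul1r subrK.
split; first exact: (form_dom h (a - 1) Du Du).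
rewrite (form_expand h)// !normc_sq !complexE (form_real h Du) /=; ring.
Qed.

End forms.

(** * The frequency at which the charge term vanishes *)

Section frequency.
Variables (R : realType) (N : nat) (alpha : R).
Hypothesis hN : N = 2%N \/ N = 3%N.
Hypothesis halpha : N = 3%N -> alpha < 0.

(** In dimension 2 [omega_alpha] is the square of 2 exp(-2 pi alpha - gamma), so the logarithm in
    beta is -2 pi alpha - gamma. In dimension 3 its square root is |4 pi alpha| = -4 pi alpha, as
    alpha < 0. *)
Lemma alpha_beta_eq0 : alpha + beta_coef N (omega_alpha N alpha) = 0.
Proof.
have pi0 : 0 < pi :> R by exact: pi_gt0.
rewrite /beta_coef /omega_alpha /e_alpha; case: hN => N_ /=; rewrite N_ /=.
  set c : R := euler_gamma R; rewrite normrN ger0_norm; last first.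
    by rewrite mulr_ge0// expR_ge0.
  have -> : 4 * expR (- (4 * pi * alpha) - 2 * c) =
      (2 * expR (- (2 * pi * alpha) - c)) ^+ 2.
    rewrite exprMn -expRM_natl; congr (_ * expR _); ring.
  rewrite sqrtr_sqr ger0_norm ?mulr_ge0 ?expR_ge0//.
  rewrite mulrAC divff// mul1r expRK.
  by move: pi pi0 => P P0; field; exact: lt0r_neq0.
rewrite normrN ger0_norm ?sqr_ge0// sqrtr_sqr ltr0_norm; last first.
  by rewrite pmulr_rlt0 ?halpha// mulr_gt0.
by move: pi pi0 => P P0; field; exact: lt0r_neq0.
Qed.

End frequency.

(** * Real inequalities behind the estimates *)

Section algebra.
Variable R : realFieldType.

(** [A], [m], [K], [P] stand for the form, the squared L^2 norm, the weighted form and the potential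
    energy of u, primed letters for those of [phi], and [o] for omega; the first premise is B(phi,
    phi) = 0. *)
Fact gap_algebra (A A' m m' K K' P P' o : R) : A' + o * m' + K' = 0 ->
  P' + 2^-1 * (K - K') <= P ->
  2^-1 * (A + o * m + K) <= 2^-1 * A + P + o / 2 * m - (2^-1 * A' + P' + o / 2 * m').
Proof. lra. Qed.

Fact segment_algebra (t a b c m : R) : a <= (1 - t) * b + t * c ->
  t * c <= t * m -> 0 <= t * b -> a - b <= t * m.
Proof. lra. Qed.

Fact upper_algebra (n n' m m' P P' k a : R) b1 b2 b3 : 2^-1 * (n - n') <= b1 ->
  a * (m' - m) <= b2 -> k * (P - P') <= b3 ->
  2^-1 * n - a * m + k * P - (2^-1 * n' - a * m' + k * P') <= b1 + b2 + b3.
Proof. lra. Qed.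

Fact split_algebra (k1 a k2 k3 d : R) :
  (k1 + (1 + a) * k2 + k3) * d = k1 * d + (k2 * d + a * (k2 * d)) + k3 * d.
Proof. ring. Qed.

Fact combine_algebra (k l n d : R) :
  (2 * k + 2 * (l * n)) * d = 2 * (k * d) + 2 * (l * d * n).
Proof. ring. Qed.

Fact sum_algebra (x a b c d : R) : 0 <= a -> 0 <= c -> 0 <= d -> x <= b ->
  x <= a + (b + c) + d.
Proof. lra. Qed.

(** Here |x - 1| <= x + 1. Conservation of mass controls |a|^2 - 1, and this passes to |a| - 1. *)
Fact sub1_sq_le (x : R) : 0 <= x -> (x - 1) ^+ 2 <= `|x ^+ 2 - 1|.
Proof.
move=> x0; have -> : x ^+ 2 - 1 = (x - 1) * (x + 1) by ring.
rewrite normrM -(real_normK (num_real (x - 1))) expr2 ler_wpM2l//.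
by rewrite (@ger0_norm _ (x + 1))//; [rewrite ler_norml; lra|lra].
Qed.

Fact norm_algebra (a v l o b : R) k : 0 < o -> 0 <= l -> 0 <= k -> 0 <= v ->
  o * v <= b -> b = a + o * v + k -> a + (1 + l) * v <= b + (1 + l) * (b / o).
Proof.
move=> o0 l0 k0 v0 vb E; rewrite lerD//; first by have := mulr_ge0 (ltW o0) v0; lra.
by rewrite ler_wpM2l ?ler_pdivlMr 1?mulrC//; lra.
Qed.

End algebra.

(** * The form domain and its norm *)

Section standing_wave.
Variables (R : realType) (N : nat) (alpha p omega : R).
Local Notation C := (R[i]).
Local Notation cfun := (Rspace R N -> C).
Local Notation mu := (lebesgueN R N).
Variables (G : R -> cfun) (A : cfun -> cfun -> C) (phi : cfun).
Hypothesis hN : N = 2%N \/ N = 3%N.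
Hypothesis halpha : N = 3%N -> alpha < 0.
Hypothesis hp1 : 1 < p.
Hypothesis hG : forall lam : R, 0 < lam -> Green lam (G lam).
Hypothesis hA : form_alpha alpha G A.
Hypothesis hwp : global_wellposedness alpha G A p.
Hypothesis homega0 : 0 < omega.
Hypothesis homega : omega < omega_alpha N alpha.
Hypothesis hphi : stationary_solution G A p omega phi.
Hypothesis hphi_pos : {ae mu, forall x, 0 < phi x}.
Implicit Types u v w f : cfun.

Local Notation lam := (omega_alpha N alpha).
Local Notation H1a := (H1a G).
Local Notation Lq := (@Lq R N (p + 1)).
Local Notation Phi := (@Phi R N (p + 1)).

Let lam0 : 0 < lam. Proof. exact: lt_trans homega. Qed.
Let q2 : 2 < p + 1. Proof. by move: hp1; lra. Qed.
Let LG : L2 (G lam). Proof. exact: (hG lam0).1. Qed.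

Lemma H1a_clin a u v : H1a u -> H1a v -> H1a (clin a u v).
Proof.
move=> hu hv l l0; have [f [c [Hf ->]]] := hu l l0; have [f' [c' [Hf' ->]]] := hv l l0.
exists (clin a f f'), (a * c + c'); split; first exact: H1_clin.
by apply/funext => x; rewrite /clin; ring.
Qed.

Lemma H1_H1a f : H1 f -> H1a f.
Proof.
move=> Hf l l0; exists f, 0; split => //.
by apply/funext => x; rewrite mul0r addr0.
Qed.

Definition nsq u : R := complex.Re (A u u) + (1 + lam) * L2norm u ^+ 2.

Lemma H1a_decomposition u : H1a u -> exists f g c,
  [/\ L2 f, weak_gradient f g, u = clin c (G lam) f,
   complex.Im (A u u) = 0 &
   complex.Re (A u u) = \sum_(j < N) L2norm (g j) ^+ 2 + lam * L2norm f ^+ 2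
     - lam * L2norm u ^+ 2].
Proof.
move=> hu; have [f [c [[Lf [g Hg]] uE]]] := hu _ lam0.
have := hA.2.2 lam f g c lam0 (conj Lf (ex_intro _ g Hg)) Hg.
rewrite /= alpha_beta_eq0// mul0r addr0 -uE => Auu.
exists f, g, c; split => //; rewrite ?Auu//.
by rewrite uE; apply/funext => x; rewrite /clin addrC.
Qed.

Lemma H1a_L2 u : H1a u -> L2 u.
Proof. by move=> /H1a_decomposition[f [g [c [Lf _ -> _ _]]]]; exact: L2_clin. Qed.

Lemma hermitian_A : hermitian_form H1a A.
Proof.
split.
- exact: H1a_clin.
- exact: hA.1.
- exact: hA.2.1.
- by move=> u /H1a_decomposition[f [g [c []]]].
Qed.

Lemma hermitian_inner_H1a : hermitian_form H1a (@inner R N).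
Proof.
exact: hermitian_form_sub (@hermitian_inner R N) H1a_clin H1a_L2.
Qed.

Let hI := hermitian_inner_H1a.

Lemma Re_inner_self u : complex.Re (inner u u) = L2norm u ^+ 2.
Proof. by rewrite inner_self. Qed.

Definition norm_form u w : C := A u w + (1 + lam)%:C * inner u w.

Lemma hermitian_norm_form : hermitian_form H1a norm_form.
Proof. exact: hermitian_formD hermitian_A hI. Qed.

Let hM := hermitian_norm_form.

Lemma norm_formE u : complex.Re (norm_form u u) = nsq u.
Proof. by rewrite /norm_form inner_self !complexE /= mul0r subr0. Qed.

(** The part lam |u|^2 of the norm cancels the negative part of the form; what remains is a sum of
    squares. *)
Lemma nsq_decomposition u f (g : 'I_N -> cfun) :
  complex.Re (A u u) = \sum_(j < N) L2norm (g j) ^+ 2 + lam * L2norm f ^+ 2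
     - lam * L2norm u ^+ 2 ->
  nsq u = \sum_(j < N) L2norm (g j) ^+ 2 + lam * L2norm f ^+ 2 + L2norm u ^+ 2.
Proof. by move=> E; rewrite /nsq E; ring. Qed.

Lemma L2norm_le_nsq u : H1a u -> L2norm u ^+ 2 <= nsq u.
Proof.
move=> /H1a_decomposition[f [g [c [Lf Hg uE _ E]]]].
rewrite (nsq_decomposition E) lerDr; apply: addr_ge0.
  by rewrite sumr_ge0// => j _; rewrite sqr_ge0.
by apply: mulr_ge0; rewrite ?sqr_ge0 ?ltW.
Qed.

Lemma nsq_ge0 u : H1a u -> 0 <= nsq u.
Proof. by move=> /L2norm_le_nsq; apply: le_trans; exact: sqr_ge0. Qed.

Let norm_form_ge0 u : H1a u -> 0 <= complex.Re (norm_form u u).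
Proof. by rewrite norm_formE; exact: nsq_ge0. Qed.

(* The eigenvector of the only negative eigenvalue is [G lam]. *)
Lemma A_ge0_orthogonal w : H1a w -> inner w (G lam) = 0 ->
  0 <= complex.Re (A w w).
Proof.
move=> Hw w0; have [f [g [c [Lf Hg wE _ ->]]]] := H1a_decomposition Hw.
have Lw := H1a_L2 Hw.
have fE : f = clin (- c) (G lam) w.
  by apply/funext => x; rewrite wE /clin; ring.
have Gw0 : inner (G lam) w = 0.
  by rewrite (form_sym (@hermitian_inner R N) Lw LG) w0; apply: complex_ext;
    rewrite !complexE /= ?oppr0.
(* Pythagoras: f = w - c G_lam with [w] orthogonal to G_lam. *)
have : L2norm w ^+ 2 <= L2norm f ^+ 2.
  rewrite -!Re_inner_self [in leRHS]fE (form_expand (@hermitian_inner R N))//.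
  by rewrite Gw0 mulr0 mulr0 addr0 lerDr mulr_ge0 ?sqr_ge0// inner_ge0.
move=> wf; have : 0 <= \sum_(j < N) L2norm (g j) ^+ 2.
  by rewrite sumr_ge0// => j _; rewrite sqr_ge0.
have := ler_wpM2l (ltW lam0) wf; lra.
Qed.

(** The evolution equation at time 0, for a solution U with datum [u], includes the integrability of
    |U(0)|^(p-1) U(0) conj(w) for all w in the form domain; w = U(0) gives the power p + 1. *)
Lemma H1a_Lq u : H1a u -> Lq u.
Proof.
move=> Hu; have [[Tmin [Tmax [U [[evU _] U0]]]] _] := hwp Hu.
have [T1 [T2 [HU [_ [du [_ [_ [_ eqU]]]]]]]] := evU.
have I0 : in_interval Tmin Tmax 0.
  by split => //; rewrite oppe_lt0.
have HU0 := HU _ I0; have [[i1 _] _] := eqU _ I0 _ HU0.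
apply: (Lq_ae U0 (H1a_L2 Hu).1); split; first exact: (H1a_L2 HU0).1.
have E x : complex.Re (power_nonlinearity p (U 0) x * ((U 0 x)^*)%C) =
    Normc.normc (U 0 x) `^ (p + 1).
  rewrite /power_nonlinearity -mulrA mul_conj -rmorphM /=.
  set s := Normc.normc _; have s0 : 0 <= s by exact: normc_ge0.
  have [->|sn0] := eqVneq s 0.
    by rewrite expr0n mulr0 powR0//; apply/eqP; move: hp1; lra.
  rewrite -powR_mulrn// -powRD ?sn0 ?implybT//; congr powR; ring.
by move: i1; under eq_fun do rewrite E.
Qed.

(** * The linearized form and its spectral gap *)

Let Hphi : H1a phi. Proof. exact: hphi.1. Qed.

Definition weighted_form u w : C :=
  cintegral (fun x => (Normc.normc (phi x) `^ (p - 1))%:C * u x * ((w x)^*)%C).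

(** The product |u||w| is at most |u|^2 + |w|^2, and [powR_young] integrates each square against
    |phi|^(p-1). *)
Lemma weighted_cintegrable u w : H1a u -> H1a w ->
  cintegrable (fun x => (Normc.normc (phi x) `^ (p - 1))%:C * u x * ((w x)^*)%C).
Proof.
move=> Hu Hw; have [mp ip] := H1a_Lq Hphi.
have [mu_ iu] := H1a_Lq Hu; have [mw iw] := H1a_Lq Hw.
apply: (@cintegrable_le _ _ _ (fun x =>
   (Normc.normc (u x) `^ (p + 1) + Normc.normc (phi x) `^ (p + 1))
   + (Normc.normc (w x) `^ (p + 1) + Normc.normc (phi x) `^ (p + 1)))).
- apply: cmeasurable_mul (cmeasurable_conj mw); apply: cmeasurable_mul mu_.
  by apply: cmeasurable_real; exact: measurable_power mp.
- by apply: rintegrableD; exact: rintegrableD.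
move=> x; rewrite !Normc.normcM normc_conj normc_real ger0_norm ?powR_ge0//.
set b := Normc.normc (phi x); set s := Normc.normc (u x); set t := Normc.normc (w x).
have b0 : 0 <= b by exact: normc_ge0.
have s0 : 0 <= s by exact: normc_ge0.
have t0 : 0 <= t by exact: normc_ge0.
have h1 := powR_young q2 s0 b0; have h2 := powR_young q2 t0 b0.
have pE : p + 1 - 2 = p - 1 by ring.
rewrite pE in h1 h2; apply: le_trans (lerD h1 h2); rewrite -mulrDr -mulrA.
rewrite ler_wpM2l ?powR_ge0//; have := sqr_ge0 (s - t); have := mulr_ge0 s0 t0.
by rewrite sqrrB; lra.
Qed.

Lemma weighted_self_pt u x :
  (Normc.normc (phi x) `^ (p - 1))%:C * u x * ((u x)^*)%C =
  (Normc.normc (phi x) `^ (p - 1) * Normc.normc (u x) ^+ 2)%:C.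
Proof. by rewrite -mulrA mul_conj -rmorphM. Qed.

Lemma weighted_self u : complex.Re (weighted_form u u) =
  \int[mu]_x (Normc.normc (phi x) `^ (p - 1) * Normc.normc (u x) ^+ 2).
Proof. by apply: eq_Rintegral => x _; rewrite weighted_self_pt. Qed.

Lemma hermitian_weighted : hermitian_form H1a weighted_form.
Proof.
split.
- exact: H1a_clin.
- move=> a u v w Du Dv Dw; rewrite /weighted_form.
  rewrite -cintegral_clin; [|exact: weighted_cintegrable..].
  by congr cintegral; apply/funext => x; rewrite /clin; ring.
- move=> a u v w Du Dv Dw; rewrite /weighted_form.
  rewrite -cintegral_clin; [|exact: weighted_cintegrable..].
  by congr cintegral; apply/funext => x; rewrite /clin rmorphD rmorphM; ring.
- move=> u Du; rewrite /weighted_form /cintegral /=.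
  by under eq_Rintegral do rewrite weighted_self_pt /=; rewrite Rintegral_cst// mul0r.
Qed.

(** The form B, of the operator usually denoted L_-: its potential is |phi|^(p-1) without the factor
    p, so it is complex linear in [u] and the stationary equation says that [phi] is in its kernel.
    The factor 1 fits the shape of [hermitian_formD]. *)
Definition linearized u w : C := A u w + omega%:C * inner u w + 1%:C * weighted_form u w.

Lemma hermitian_linearized : hermitian_form H1a linearized.
Proof.
exact: hermitian_formD (hermitian_formD omega hermitian_A hI) hermitian_weighted.
Qed.

Let hB := hermitian_linearized.

Lemma linearized_phi w : H1a w -> linearized phi w = 0.
Proof.
move=> Hw; have [_ <-] := hphi.2 _ Hw; rewrite /linearized mul1r.
by [].
Qed.

Lemma Re_linearized u : complex.Re (linearized u u) =
  complex.Re (A u u) + omega * L2norm u ^+ 2 + complex.Re (weighted_form u u).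
Proof. by rewrite /linearized inner_self !complexE /=; ring. Qed.

Lemma weighted_ge0 u : 0 <= complex.Re (weighted_form u u).
Proof.
rewrite weighted_self; apply: rintegral_ge0 => x.
by rewrite mulr_ge0 ?powR_ge0 ?sqr_ge0.
Qed.

(** With zero norm [phi] would be both zero and positive at almost every point of a space of
    positive measure. *)
Lemma L2norm_phi_gt0 : 0 < L2norm phi ^+ 2.
Proof.
rewrite lt_def sqr_ge0 andbT; apply/eqP => phi0.
have := @rintegral_eq0 _ _ _ mu (fun x => Normc.normc (phi x) ^+ 2) (H1a_L2 Hphi).2.
rewrite -L2norm_sq => /(_ (fun x => sqr_ge0 _) phi0) phi_ae.
have : {ae mu, forall x, False}.
  apply: filterS2 phi_ae hphi_pos => x /eqP.
  rewrite expf_eq0/= => /eqP /Normc.eq0_normc ->.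
  by rewrite ltxx.
move=> [E [mE E0 sub]].
have := @lebesgueN_setT_gt0 R N; suff -> : [set: Rspace R N] = E by rewrite E0 ltxx.
by apply/seteqP; split => // x _; apply: sub => /=.
Qed.

Let m0 := L2norm_phi_gt0.

(* Some combination of [phi] and [v] is orthogonal to [G lam], and the kernel
   element [phi] does not contribute to the form. *)
Lemma linearized_gap v : H1a v -> inner v phi = 0 ->
  omega * L2norm v ^+ 2 <= complex.Re (linearized v v).
Proof.
move=> Hv v0.
have above w : H1a w -> inner w (G lam) = 0 ->
    omega * L2norm w ^+ 2 <= complex.Re (linearized w w).
  move=> Hw w0; rewrite Re_linearized; have := A_ge0_orthogonal Hw w0.
  by have := weighted_ge0 w; lra.
(* Were [phi] orthogonal to G_lam, the bound applied to [phi] would give omega |phi|^2 <= 0; hence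
   the division in [b] is legitimate. *)
have [s0|s0] := eqVneq (inner phi (G lam)) 0.
  have := above _ Hphi s0; rewrite linearized_phi//= pmulr_rle0//.
  by rewrite leNgt m0.
pose b := - (inner v (G lam) / inner phi (G lam)).
have Hw := H1a_clin b Hphi Hv.
have w0 : inner (clin b phi v) (G lam) = 0.
  rewrite (form_linl (@hermitian_inner R N) _ (H1a_L2 Hphi) (H1a_L2 Hv) LG).
  by rewrite /b mulNr divfK// addNr.
(* The term b phi drops out of B, and orthogonality to [phi] gives |b phi + v|^2 >= |v|^2. *)
have := above _ Hw w0; rewrite -Re_inner_self (form_expand hI)// (form_expand hB)//.
have R0 : complex.Re (0 : C) = 0 by [].
have pv0 : inner phi v = 0.
  rewrite (form_sym hI Hv Hphi) v0; apply: complex_ext; rewrite !complexE //=.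
  by rewrite oppr0.
rewrite !linearized_phi// pv0 -Re_inner_self ?(mulr0, R0, addr0, add0r).
apply: le_trans.
by rewrite ler_pM2l// lerDr mulr_ge0 ?sqr_ge0// inner_ge0.
Qed.

(** * The action near [phi], and stability *)

Definition action u : R := energy A p u + omega / 2 * L2norm u ^+ 2.

Lemma actionE u : action u = 2^-1 * complex.Re (A u u) + (p + 1)^-1 * Phi u
  + omega / 2 * L2norm u ^+ 2.
Proof. by []. Qed.

(** The quadratic part of S is kept exactly. Only the potential energy is estimated, by its tangent
    in |u|^2 at |phi|^2, which yields half the difference of the weighted forms; B(phi, phi) = 0
    then removes the terms in [phi]. *)
Lemma action_gap u : H1a u ->
  2^-1 * complex.Re (linearized u u) <= action u - action phi.
Proof.
move=> Hu.
have := linearized_phi Hphi => /(congr1 (@complex.Re R)).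
have R0 : complex.Re (0 : C) = 0 by [].
rewrite Re_linearized R0 => Bphi.
have q0 : 0 < p + 1 by move: q2; lra.
have [_ iu] := H1a_Lq Hu; have [_ ip] := H1a_Lq Hphi.
have iK v : H1a v -> rintegrable mu
    (fun x => Normc.normc (phi x) `^ (p - 1) * Normc.normc (v x) ^+ 2).
  move=> Hv; have [+ _] := weighted_cintegrable Hv Hv.
  by under eq_fun do rewrite weighted_self_pt.
have : \int[mu]_x (Normc.normc (phi x) `^ (p + 1) + (p + 1) / 2 *
     (Normc.normc (phi x) `^ (p - 1) * Normc.normc (u x) ^+ 2 -
      Normc.normc (phi x) `^ (p - 1) * Normc.normc (phi x) ^+ 2)) <= Phi u.
  apply: rintegral_le => [||x].
  - by apply: rintegrableD ip _; apply: rintegrableZ; apply: rintegrableB; exact: iK.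
  - exact: iu.
  have := @powR_tangent_sq R (p + 1) (Normc.normc (u x)) (Normc.normc (phi x)) q2
    (normc_ge0 _) (normc_ge0 _).
  have -> : p + 1 - 2 = p - 1 by ring.
  by rewrite -mulrBr mulrA.
rewrite (rintegral_D ip (rintegrableZ _ (rintegrableB (iK _ Hu) (iK _ Hphi)))).
rewrite (rintegral_Z _ (rintegrableB (iK _ Hu) (iK _ Hphi))).
rewrite (rintegral_B (iK _ Hu) (iK _ Hphi)).
rewrite -!weighted_self -/(Phi u) -/(Phi phi) => key.
rewrite Re_linearized !actionE.
set Ku := complex.Re (weighted_form u u) in key *.
set Kphi := complex.Re (weighted_form phi phi) in key Bphi *.
have : (p + 1)^-1 * Phi phi + 2^-1 * (Ku - Kphi) <= (p + 1)^-1 * Phi u.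
  apply: le_trans (ler_wpM2l _ key); last by rewrite invr_ge0 ltW.
  by rewrite le_eqVlt; apply/orP; left; apply/eqP; field; rewrite gt_eqF.
exact: gap_algebra.
Qed.

(** The direction outside H^1 is represented by some e in H^1_alpha with nonzero coefficient along
    G_lam, and not by G_lam itself, whose membership in [H1a] would require comparing Green
    functions of different frequencies. If there is no such e, or if G_lam vanishes almost
    everywhere, each u agrees almost everywhere with its part f in H^1. *)
Lemma Phi_H1a_bounded : exists M r : R, [/\ 0 <= M, 0 < r &
  forall u, H1a u -> nsq u <= r -> Phi u <= M].
Proof.
have [M0 [r0 [r00 hb]]] := Phi_H1_bounded q2 (fun f Hf => H1a_Lq (H1_H1a Hf)).
(* The squared norm of f has weight lam in [nsq] and weight 1 in [sobolev_sq]. *)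
pose k := 1 + lam^-1.
have k1 : 1 <= k by rewrite lerDl invr_ge0 ltW.
have k0 : 0 < k by exact: lt_le_trans k1.
have sob u f g c : L2 f -> weak_gradient f g -> u = clin c (G lam) f ->
    complex.Re (A u u) = \sum_(j < N) L2norm (g j) ^+ 2 + lam * L2norm f ^+ 2
     - lam * L2norm u ^+ 2 -> sobolev_sq f g <= k * nsq u.
  move=> Lf Hg uE E; rewrite (nsq_decomposition E) /sobolev_sq.
  set S := \sum_(j < N) _; have S0 : 0 <= S by rewrite sumr_ge0// => j _; rewrite sqr_ge0.
  have f0 : 0 <= L2norm f ^+ 2 by exact: sqr_ge0.
  have u0 : 0 <= L2norm u ^+ 2 by exact: sqr_ge0.
  have -> : k * (S + lam * L2norm f ^+ 2 + L2norm u ^+ 2) =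
     L2norm f ^+ 2 + S + (lam * L2norm f ^+ 2 + S / lam + k * L2norm u ^+ 2).
    by rewrite /k; field; rewrite gt_eqF.
  rewrite lerDl; apply: addr_ge0; last by apply: mulr_ge0 => //; exact: ltW.
  by apply: addr_ge0; apply: mulr_ge0 => //; rewrite ?invr_ge0 ltW.
have regular u f g : H1a u -> L2 f -> weak_gradient f g -> Phi u = Phi f ->
    sobolev_sq f g <= k * nsq u -> nsq u <= r0 / k -> Phi u <= Num.max M0 0.
  move=> Hu Lf Hg -> fu hu; rewrite le_max (hb f g)//.
  apply: le_trans fu _; apply: le_trans (ler_wpM2l (ltW k0) hu) _.
  by rewrite mulrC divfK// gt_eqF.
have [G0|G0] := eqVneq (L2norm (G lam) ^+ 2) 0.
  exists (Num.max M0 0), (r0 / k); split; [by rewrite le_max lexx orbT|exact: divr_gt0|].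
  move=> u Hu hu; have [f [g [c [Lf Hg uE _ E]]]] := H1a_decomposition Hu.
  apply: (regular u f g Hu Lf Hg _ (sob u f g c Lf Hg uE E) hu).
  apply: Phi_ae; [|exact: (H1a_L2 Hu).1|exact: Lf.1].
  have := @rintegral_eq0 _ _ _ mu (fun x => Normc.normc (G lam x) ^+ 2) LG.2.
  rewrite -L2norm_sq => /(_ (fun x => sqr_ge0 _) G0).
  apply: filterS => x /eqP; rewrite expf_eq0/= => /eqP /Normc.eq0_normc Gx.
  by rewrite uE /clin Gx mulr0 add0r.
have [[e [fe [ge [ce [He Lfe Hge eE ce0]]]]]|none] :=
   pselect (exists e f g c, [/\ H1a e, L2 f, weak_gradient f g,
     e = clin c (G lam) f & c != 0]);
   last first.
  exists (Num.max M0 0), (r0 / k); split; [by rewrite le_max lexx orbT|exact: divr_gt0|].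
  move=> u Hu hu; have [f [g [c [Lf Hg uE _ E]]]] := H1a_decomposition Hu.
  apply: (regular u f g Hu Lf Hg _ (sob u f g c Lf Hg uE E) hu).
  have [c0|c0] := eqVneq c 0; last by case: none; exists u, f, g, c.
  by congr Phi; rewrite uE c0; apply/funext => x; rewrite /clin mul0r add0r.
have Gp : 0 < L2norm (G lam) ^+ 2 by rewrite lt_def G0 sqr_ge0.
have nce : 0 < Normc.normc ce ^+ 2.
  rewrite lt_def sqr_ge0 andbT expf_eq0 /=; apply: contra ce0 => /eqP /Normc.eq0_normc ->.
  by [].
(* From c G_lam = u - f one gets |c|^2 |G_lam|^2 <= 2 (1 + k) nsq(u); the coefficient along e is c /
   [ce]. *)
pose kb := 2 * (1 + k) / (L2norm (G lam) ^+ 2 * Normc.normc ce ^+ 2).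
have kb0 : 0 < kb.
  by apply: divr_gt0; apply: mulr_gt0 => //; apply: addr_gt0.
pose Se := sobolev_sq fe ge.
have Se0 : 0 <= Se by exact: sobolev_sq_ge0.
pose K := 2 * kb * Se + 2 * k.
have K0 : 0 < K.
  apply: ltr_wpDl; last exact: mulr_gt0.
  by apply: mulr_ge0 => //; apply: mulr_ge0 => //; exact: ltW.
(* The first radius puts u - b e in the ball of [Phi_H1_bounded]; the second gives |b| <= 1, hence
   Phi(b e) <= Phi(e). *)
exists (2 `^ (p + 1) * (Phi e + Num.max M0 0)), (Num.min (r0 / K) (kb^-1)); split.
- by rewrite mulr_ge0 ?powR_ge0// addr_ge0 ?Phi_ge0// le_max lexx orbT.
- by rewrite lt_min divr_gt0 ?invr_gt0.
move=> u Hu; rewrite le_min => /andP[hu1 hu2].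
have [f [g [c [Lf Hg uE _ E]]]] := H1a_decomposition Hu.
have fS := sob u f g c Lf Hg uE E.
pose b := c / ce.
have nb : Normc.normc b ^+ 2 <= kb * nsq u.
  have cG : L2norm (clin (c - 1) (G lam) (G lam)) ^+ 2 =
      Normc.normc c ^+ 2 * L2norm (G lam) ^+ 2.
    have -> : clin (c - 1) (G lam) (G lam) = (fun x => c * G lam x).
      by apply/funext => x; rewrite /clin; ring.
    by rewrite -!Re_inner_self (form_scale _ (@hermitian_inner R N) LG).2.
  have h : Normc.normc c ^+ 2 * L2norm (G lam) ^+ 2 <=
      2 * L2norm u ^+ 2 + 2 * L2norm f ^+ 2.
    rewrite -cG; have -> : clin (c - 1) (G lam) (G lam) = clin 1 u (clin (- 2%:R) f f).
      by rewrite uE; apply/funext => x; rewrite /clin; ring.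
    apply: le_trans (L2norm_clin_le (H1a_L2 Hu) (L2_clin _ Lf Lf)) _.
    have -> : L2norm (clin (- 2%:R) f f) = L2norm f.
      congr (Num.sqrt (Rintegral _ _ _)); apply/funext => x.
      have -> : clin (- 2%:R) f f x = - f x by rewrite /clin; ring.
      by rewrite normcN.
    by [].
  have h2 := L2norm_le_nsq Hu; have h3 := L2norm_le_sobolev f g.
  rewrite /b Normc.normcM Normc.normcV expr_div_n /kb.
  have -> : 2 * (1 + k) / (L2norm (G lam) ^+ 2 * Normc.normc ce ^+ 2) * nsq u =
    2 * (1 + k) * nsq u / L2norm (G lam) ^+ 2 / Normc.normc ce ^+ 2.
    move: (L2norm (G lam) ^+ 2) (Normc.normc ce ^+ 2) Gp nce => s1 s2 s10 s20.
    by field; rewrite !gt_eqF.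
  by rewrite ler_pM2r ?invr_gt0// ler_pdivlMr//; lra.
pose hf := clin (- b) fe f; pose hg j := clin (- b) (ge j) (g j).
have Hhg : weak_gradient hf hg by exact: weak_gradient_clin.
have Lhf : L2 hf by exact: L2_clin.
have hS : sobolev_sq hf hg <= r0.
  apply: le_trans (sobolev_sq_clin (- b) Lfe Lf Hge.1 Hg.1) _.
  rewrite normcN -/Se; apply: (@le_trans _ _ (K * nsq u)).
    have := ler_wpM2r Se0 nb; rewrite /K; lra.
  by rewrite mulrC -ler_pdivlMr.
have uE2 : u = clin 1 (fun x => b * e x) hf.
  rewrite uE eE; apply/funext => x; rewrite /clin /hf /clin /b; field; exact: ce0.
have [Hbe _] := form_scale b hermitian_A He.
have Hh : H1a hf by apply: H1_H1a; split => //; exists hg.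
rewrite uE2; apply: le_trans (Phi_le2 q2 (H1a_Lq Hbe) (H1a_Lq Hh)) _.
rewrite ler_wpM2l ?powR_ge0// lerD//; last by rewrite le_max (hb hf hg).
apply: rintegral_le; [exact: (H1a_Lq Hbe).2|exact: (H1a_Lq He).2|move=> x].
apply: ge0_ler_powR; rewrite ?nnegrE ?normc_ge0//; first by move: q2; lra.
rewrite Normc.normcM -[leRHS]mul1r ler_wpM2r ?normc_ge0//.
rewrite -(@ler_pXn2r _ 2)// ?nnegrE ?normc_ge0// expr1n; apply: le_trans nb _.
by rewrite mulrC -ler_pdivlMr// div1r.
Qed.

(** Quadratic terms are expanded. For [Phi], phi + w is the point of parameter t = d / rho on the
    segment from phi to phi + w/t, whose far end stays where [Phi] is bounded. *)
Lemma action_upper : exists K r : R, [/\ 0 <= K, 0 < r & forall w d, H1a w ->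
  0 < d -> d <= r -> nsq w <= d ^+ 2 ->
  action (clin 1 w phi) - action phi <= K * d /\
  `|L2norm (clin 1 w phi) ^+ 2 - L2norm phi ^+ 2| <= K * d].
Proof.
have [M [r [M0 r0 hMr]]] := Phi_H1a_bounded.
pose rho := Num.min 1 r.
have rho0 : 0 < rho by rewrite lt_min ltr01.
have rho1 : rho <= 1 by rewrite ge_min lexx.
have rhor : rho <= r by rewrite ge_min lexx orbT.
pose M' := 2 `^ (p + 1) * (Phi phi + M).
have M'0 : 0 <= M' by rewrite mulr_ge0 ?powR_ge0// addr_ge0 ?Phi_ge0.
have q0 : 0 < p + 1 by move: q2; lra.
pose K1 := 2^-1 * (2 + nsq phi); pose K2 := 2 + L2norm phi ^+ 2.
pose K3 := (p + 1)^-1 * M' / rho.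
have phi0 := nsq_ge0 Hphi.
have K10 : 0 <= K1 by rewrite mulr_ge0//; lra.
have K20 : 0 <= K2 by rewrite addr_ge0// sqr_ge0.
have K30 : 0 <= K3.
  by apply: mulr_ge0; rewrite ?invr_ge0 ?(ltW rho0)//;
    apply: mulr_ge0; rewrite // invr_ge0 ltW.
have lamo : 0 <= (1 + lam - omega) / 2 by move: homega lam0; lra.
(* [K2] is counted for the mass and again for the mass term left over when the action is written
   with [nsq]. *)
exists (K1 + (1 + (1 + lam - omega) / 2) * K2 + K3), rho; split => //.
  by apply: addr_ge0 => //; apply: addr_ge0 => //; apply: mulr_ge0 => //; apply: addr_ge0.
move=> w d Hw d0 dr nw; have d1 : d <= 1 by exact: le_trans rho1.
have dd : d ^+ 2 <= d by rewrite expr2 ler_piMr// ltW.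
have Hu := H1a_clin 1 Hw Hphi.
have quad S : hermitian_form H1a S -> (forall u, H1a u -> 0 <= complex.Re (S u u)) ->
   complex.Re (S w w) <= d ^+ 2 ->
   `|complex.Re (S (clin 1 w phi) (clin 1 w phi)) - complex.Re (S phi phi)|
   <= (2 + complex.Re (S phi phi)) * d.
  move=> hS S0 Sw; rewrite (form_expand1 hS)// addrK.
  (* The parameter 1/d balances S(w, w) <= d^2 against S(phi, phi) and makes the cross term O(d). *)
  have Y := form_young hS S0 (_ : 0 < d^-1) Hw Hphi.
  have {}Y : 2 * `|complex.Re (S w phi)| <= d + d * complex.Re (S phi phi).
    apply: le_trans (Y _) _; rewrite ?invr_gt0// invrK [X in _ + X]mulrC lerD2r.
    by rewrite mulrC ler_pdivrMr// -expr2.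
  have Sw0 := S0 _ Hw; have p0 := S0 _ Hphi.
  apply: le_trans (ler_normD _ _) _; rewrite (ger0_norm Sw0) normrM ger0_norm//; lra.
have A1 : `|nsq (clin 1 w phi) - nsq phi| <= (2 + nsq phi) * d.
  have := quad _ hM norm_form_ge0; rewrite !norm_formE; exact.
have A2 : `|L2norm (clin 1 w phi) ^+ 2 - L2norm phi ^+ 2| <= K2 * d.
  have := quad _ hI (fun u _ => inner_ge0 u); rewrite !Re_inner_self; apply.
  exact: le_trans (L2norm_le_nsq Hw) nw.
have A3 : Phi (clin 1 w phi) - Phi phi <= M' / rho * d.
  pose t := d / rho.
  have t0 : 0 < t by rewrite divr_gt0.
  have t1 : t <= 1 by rewrite ler_pdivrMr// mul1r.
  pose w' : cfun := fun x => (t^-1)%:C * w x.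
  have [Hw' nw'] := form_scale (t^-1)%:C hM Hw.
  have Phiw' : Phi w' <= M.
    apply: hMr => //; rewrite -norm_formE nw' norm_formE normc_real real_normK ?num_real//.
    apply: (@le_trans _ _ (t^-1 ^+ 2 * d ^+ 2)); first by rewrite ler_wpM2l ?sqr_ge0.
    rewrite -exprMn /t invf_div mulrAC -mulrA divff ?gt_eqF// mulr1.
    by apply: le_trans rhor; rewrite expr2 ler_piMr// ltW.
  have Hz := H1a_clin 1 Hw' Hphi.
  have Phiz : Phi (clin 1 w' phi) <= M'.
    apply: le_trans (Phi_le2 q2 (H1a_Lq Hw') (H1a_Lq Hphi)) _.
    by rewrite ler_wpM2l ?powR_ge0// addrC lerD2l.
  have uE : clin 1 w phi = fun x => (1 - t)%:C * phi x + t%:C * clin 1 w' phi x.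
    apply/funext => x; rewrite /clin /w' !mul1r mulrDr mulrA -rmorphM divff ?gt_eqF//.
    by rewrite rmorphB /= rmorph1; ring.
  have t01 : 0 <= t <= 1 by rewrite t1 ltW.
  have := Phi_segment q2 t01 (H1a_Lq Hphi) (H1a_Lq Hz); rewrite -uE => seg.
  have -> : M' / rho * d = t * M' by rewrite /t mulrC mulrA mulrAC.
  exact: segment_algebra seg (ler_wpM2l (ltW t0) Phiz)
    (mulr_ge0 (ltW t0) (Phi_ge0 (p + 1) phi)).
have b0 : 0 <= K1 * d by apply: mulr_ge0 => //; exact: ltW.
have c0 : 0 <= K3 * d by apply: mulr_ge0 => //; exact: ltW.
have e0 : 0 <= K2 * d by apply: mulr_ge0 => //; exact: ltW.
have a0 : 0 <= (1 + lam - omega) / 2 * (K2 * d) by exact: mulr_ge0.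
rewrite split_algebra; split; last exact: sum_algebra.
have actE u : action u =
    2^-1 * nsq u - (1 + lam - omega) / 2 * L2norm u ^+ 2 + (p + 1)^-1 * Phi u.
  by rewrite actionE /nsq; field; rewrite gt_eqF.
rewrite !actE.
have B1 : 2^-1 * (nsq (clin 1 w phi) - nsq phi) <= K1 * d.
  by rewrite /K1 -mulrA ler_pM2l// (le_trans (ler_norm _) A1).
have B2 : (1 + lam - omega) / 2 * (L2norm phi ^+ 2 - L2norm (clin 1 w phi) ^+ 2)
     <= (1 + lam - omega) / 2 * (K2 * d).
  by rewrite ler_wpM2l//; apply: le_trans A2; rewrite distrC ler_norm.
have B3 : (p + 1)^-1 * (Phi (clin 1 w phi) - Phi phi) <= K3 * d.
  have -> : K3 * d = (p + 1)^-1 * (M' / rho * d) by rewrite /K3 !mulrA.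
  by rewrite ler_pM2l// invr_gt0.
apply: le_trans (upper_algebra B1 B2 B3) _; rewrite lerD2r lerD2l.
by rewrite lerDr.
Qed.

(** Write u = a phi + v with v orthogonal to [phi]. The action gap bounds B(v, v), the spectral gap
    turns this into a bound on v, and the mass then bounds |a|^2 - 1. With a = |a| e^(i theta), u -
    e^(i theta) phi = v + (|a| - 1) e^(i theta) phi. *)
Lemma stability_estimate : exists K r : R, [/\ 0 <= K, 0 < r & forall d u0 u,
  0 < d -> d <= r -> H1a u0 -> H1a u -> nsq (csub u0 phi) <= d ^+ 2 ->
  L2norm u = L2norm u0 -> energy A p u = energy A p u0 ->
  exists theta, H1a (csub u (fun x => cexpi theta * phi x)) /\
    nsq (csub u (fun x => cexpi theta * phi x)) <= K * d].
Proof.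
have [K [r [K0 r0 hK]]] := action_upper.
have m0' := m0; pose m := L2norm phi ^+ 2.
have phi0 := nsq_ge0 Hphi.
(* Per unit of d, K bounds the initial mass defect and 2 K / omega bounds |v|^2. *)
pose L := K + 2 * K / omega.
have Ko0 : 0 <= 2 * K / omega by rewrite divr_ge0 ?(ltW homega0)// mulr_ge0.
have L0 : 0 <= L by exact: addr_ge0.
(* The outcome of [norm_algebra] when B(v, v) <= 2 K d. *)
pose P := 2 * K + (1 + lam) * (2 * K / omega).
have P0 : 0 <= P.
  by apply: addr_ge0; apply: mulr_ge0 => //; rewrite addr_ge0// ltW.
exists (2 * P + 2 * (L / m * nsq phi)), r; split => //.
  apply: addr_ge0; apply: mulr_ge0 => //; apply: mulr_ge0 => //.
  by apply: divr_ge0 => //; exact: ltW.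
move=> d u0 u d0 dr Hu0 Hu hd mass en.
have Hw : H1a (csub u0 phi) by rewrite csub_clin; exact: H1a_clin.
have u0E : u0 = clin 1 (csub u0 phi) phi.
  by apply/funext => x; rewrite /clin /csub mul1r subrK.
have := hK _ d Hw d0 dr hd; rewrite -u0E => -[hact hmass].
have actu : action u - action phi <= K * d by rewrite /action mass en; exact: hact.
rewrite -mass in hmass; clear hact mass en hd u0E Hw.
have [a aE] : exists a, a = inner u phi / (L2norm phi ^+ 2)%:C by eexists.
have [v vE] : exists v, v = clin (- a) phi u by eexists.
have Hv : H1a v by rewrite vE; exact: H1a_clin.
have v0 : inner v phi = 0.
  rewrite vE (form_linl hI _ Hphi Hu Hphi) inner_self mulNr aE divfK ?addNr//.
  by apply/eqP => /(congr1 (@complex.Re R)) /= E; rewrite E ltxx in m0'.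
have uE : u = clin a phi v.
  by apply/funext => x; rewrite vE /clin; ring.
have R0 : complex.Re (0 : C) = 0 by [].
have [b bE] : exists b, b = complex.Re (linearized v v) by eexists.
have Bu : complex.Re (linearized u u) = b.
  rewrite uE (form_expand hB a Hphi Hv) !linearized_phi// -bE.
  by rewrite ?(mulr0, R0, addr0, add0r).
have bK : b <= 2 * K * d.
  have := le_trans (action_gap Hu) actu; rewrite Bu ler_pdivrMl//.
  by rewrite -(mulrA 2 K d).
clear actu Bu.
have gap := linearized_gap Hv v0; rewrite -bE in gap.
have nv : nsq v <= b + (1 + lam) * (b / omega).
  exact: (norm_algebra homega0 (ltW lam0) (weighted_ge0 v) (sqr_ge0 _) gap
    (etrans bE (Re_linearized v))).
have vb : L2norm v ^+ 2 <= b / omega by rewrite ler_pdivlMr// mulrC.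
have b_om : b / omega <= 2 * K / omega * d.
  by rewrite mulrAC ler_pM2r ?invr_gt0.
have nvP : nsq v <= P * d.
  apply: le_trans nv _; rewrite [P * d]mulrDl; apply: lerD; first exact: bK.
  rewrite -[leRHS]mulrA; apply: ler_wpM2l; last exact: b_om.
  by apply: addr_ge0 => //; exact: ltW.
have pv0 : inner phi v = 0.
  rewrite (form_sym hI Hv Hphi) v0; apply: complex_ext; rewrite !complexE //=.
  by rewrite oppr0.
have massu : L2norm u ^+ 2 = Normc.normc a ^+ 2 * m + L2norm v ^+ 2.
  rewrite -Re_inner_self [in LHS]uE (form_expand hI a Hphi Hv) pv0 !Re_inner_self.
  by rewrite ?(mulr0, R0, addr0).
have aL : `|Normc.normc a ^+ 2 - 1| <= L / m * d.
  rewrite mulrAC ler_pdivlMr// -[m]gtr0_norm// -normrM mulrBl mul1r.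
  have -> : Normc.normc a ^+ 2 * m - m = (L2norm u ^+ 2 - m) - L2norm v ^+ 2.
    by rewrite massu; ring.
  apply: le_trans (ler_normB _ _) _; rewrite mulrDl lerD//.
  by rewrite ger0_norm ?sqr_ge0// (le_trans vb).
have [theta aP] := cexpi_polar a.
have nth : Normc.normc (cexpi theta) = 1 by rewrite /= cos2Dsin2 sqrtr1.
pose c := (Normc.normc a - 1)%:C * cexpi theta.
have zE : csub u (fun x => cexpi theta * phi x) = clin 1 v (fun x => c * phi x).
  apply/funext => x; rewrite /csub uE /clin /c {1}aP rmorphB rmorph1; ring.
have [Hc nc] := form_scale c hM Hphi.
exists theta; rewrite zE; split; first exact: H1a_clin.
have := form_parallelogram hM norm_form_ge0 Hv Hc; rewrite nc !norm_formE.
move=> /le_trans; apply; rewrite combine_algebra; apply: lerD.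
  by apply: ler_wpM2l => //; exact: nvP.
apply: ler_wpM2l => //; rewrite Normc.normcM nth mulr1 normc_real.
rewrite real_normK ?num_real//; apply: ler_wpM2r; first exact: phi0.
exact: le_trans (sub1_sq_le (normc_ge0 _)) aL.
Qed.

Lemma orbital_stability eps : 0 < eps -> exists2 delta : R, 0 < delta &
  forall (Tmin Tmax : \bar R) (u : R -> cfun),
    H1a_solution alpha G A p Tmin Tmax u ->
    H1a_norm alpha A (csub (u 0) phi) < delta ->
    (ereal_sup
       [set (inf [set H1a_norm alpha A
                        (csub (u t) (fun x => (cexpi theta * phi x)%R))
                 | theta in [set: R]])%:E
       | t in [set: R]] < eps%:E)%E.
Proof.
move=> eps0; have [K [r [K0 r0 hK]]] := stability_estimate.
(* The estimate concerns squared norms, whence the square. K + 1 allows K = 0, and eps / 2 keeps the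
   supremum strictly below eps. *)
pose e2 := (eps / 2) ^+ 2 / (K + 1).
have K1 : 0 < K + 1 by apply: ltr_wpDl.
have e20 : 0 < e2 by rewrite divr_gt0// exprn_gt0// divr_gt0.
pose d := Num.min r e2.
have d0 : 0 < d by rewrite lt_min r0.
have eps20 : 0 <= eps / 2 by rewrite divr_ge0// ltW.
have Kd : K * d <= (eps / 2) ^+ 2.
  apply: (@le_trans _ _ (K * e2)); first by rewrite ler_wpM2l// ge_min lexx orbT.
  apply: (@le_trans _ _ ((K + 1) * e2)); first by rewrite ler_wpM2r ?ltW// ltrDl.
  by rewrite /e2 mulrC divfK// gt_eqF.
exists d => // Tmin Tmax u Hsol hu.
have [evU _] := Hsol; have [T1 [T2 [HU _]]] := evU.
have I0 : in_interval Tmin Tmax 0 by split => //; rewrite oppe_lt0.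
have Hu0 := HU _ I0; have [_ [_ glob]] := hwp Hu0.
(* The value [u 0] serves as its own initial datum, so globality and conservation hold for [u]
   itself. *)
have [Tm [Tp cons]] := glob _ _ _ Hsol (nearW _ (fun x => erefl)).
have It t : in_interval Tmin Tmax t by rewrite Tm Tp; split => //=; rewrite ?ltNyr ?ltry.
have Hw : H1a (csub (u 0) phi) by rewrite csub_clin; exact: H1a_clin.
have hd : nsq (csub (u 0) phi) <= d ^+ 2.
  rewrite -[leLHS]sqr_sqrtr ?nsq_ge0// ler_pXn2r ?nnegrE ?sqrtr_ge0 ?ltW//.
apply: (@le_lt_trans _ _ (eps / 2)%:E); last first.
  by rewrite lte_fin ltr_pdivrMr// mulr2n mulrDr mulr1 ltrDl.
apply: ge_ereal_sup => _ [t _ <-]; rewrite lee_fin.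
have [mt et] := cons t.
have dr : d <= r by rewrite ge_min lexx.
have [theta [_ hth]] := hK d (u 0) (u t) d0 dr Hu0 (HU _ (It t)) hd mt et.
apply: (@le_trans _ _ (H1a_norm alpha A (csub (u t) (fun x => cexpi theta * phi x)))).
  by apply: ge_inf; [exists 0 => _ [s _ <-]; exact: sqrtr_ge0|exists theta].
rewrite -[leRHS](ger0_norm eps20) -sqrtr_sqr; apply: ler_wsqrtr.
exact: le_trans hth Kd.
Qed.

End standing_wave.

Theorem theorem1p6 (R : realType) (N : nat) (alpha p omega : R)
    (G : R -> (Rspace R N -> R[i]))
    (A : (Rspace R N -> R[i]) -> (Rspace R N -> R[i]) -> R[i])
    (phi : Rspace R N -> R[i])
    (hN : N = 2%N \/ N = 3%N)
    (halpha : N = 3%N -> alpha < 0)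
    (hp1 : 1 < p)
    (hp2 : N = 3%N -> p < 2)
    (hG : forall lam : R, 0 < lam -> Green lam (G lam))
    (hA : form_alpha alpha G A)
    (hwp : global_wellposedness alpha G A p)
    (homega0 : 0 < omega)
    (homega : omega < omega_alpha N alpha)
    (hphi : stationary_solution G A p omega phi)
    (hphi_pos : {ae lebesgueN R N, forall x, 0 < phi x}) :
  forall eps : R, 0 < eps -> exists2 delta : R, 0 < delta &
    forall (Tmin Tmax : \bar R) (u : R -> (Rspace R N -> R[i])),
      H1a_solution alpha G A p Tmin Tmax u ->
      H1a_norm alpha A (csub (u 0) phi) < delta ->
      (ereal_sup
         [set (inf [set H1a_norm alpha A
                          (csub (u t) (fun x => cexpi theta * phi x))
                   | theta in [set: R]])%:E
         | t in [set: R]] < eps%:E)%E.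
Proof.
exact: (orbital_stability hN halpha hp1 hG hA hwp homega0 homega hphi hphi_pos).
Qed.
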